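(* Assume $\alpha>3$. There exist two positive constants $\mathbf c$ and $\mathbf c'$ such that, as $n\to\infty$, $$\frac{\log n}{n}\,\mathscr L((0,0),n)\longrightarrow \mathbf c'\quad\text{and}\quad \frac{\log n}{n}\,\mathscr L(K^c,n)\longrightarrow \mathbf c$$ in probability.
   Context: Let $K^c=\{(x,y)\in\mathbb Z^2: xy=0\}$ (the axis) and $K=\mathbb Z^2\setminus K^c$. Let $\alpha\ge 0$ and let $\mathbf X=(X_n)_{n\ge 0}$ be the Markov chain on $\mathbb Z^2$ started at $X_0=(1,1)$ with the following transition probabilities. From $x\in K$ the walk is a simple random walk: it jumps to each of its four nearest neighbours with probability $1/4$. From the origin it jumps to each of the four nearest neighbours with probability $1/4$. For every integer $i>0$, $p((i,0),(i+1,0))=p((i,0),(i,1))=p((i,0),(i,-1))=p((0,i),(0,i+1))=p((0,i),(1,i))=p((0,i),(-1,i))=\frac1{4i^\alpha}$ and $p((i,0),(i-1,0))=p((0,i),(0,i-1))=1-\frac{3}{4i^\alpha}$, and symmetrically on the negative half-axes (with $i$ replaced by $|i|$, the probability $1-\frac{3}{4|i|^\alpha}$ being that of the step towards the origin). For $A\subset\mathbb Z^2$ (a point being identified with a singleton), $\mathscr L(A,n)=\sum_{i=1}^n\mathbf 1_{X_i\in A}$ is the local time of $\mathbf X$ in $A$ until time $n$. *)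

(* Defs.v *)
From HB Require Import structures.
From mathcomp Require Import all_boot all_order all_algebra.
From mathcomp Require Import all_classical all_reals all_analysis.

Set Implicit Arguments.
Unset Strict Implicit.
Unset Printing Implicit Defensive.

Import Order.TTheory GRing.Theory Num.Theory.
Import numFieldNormedType.Exports.

Local Open Scope classical_set_scope.
Local Open Scope ring_scope.

Definition Kc : set (int * int) := [set x | x.1 * x.2 = 0].

Definition neighbors (x y : int * int) : bool :=
  (`|x.1 - y.1| + `|x.2 - y.2|)%R == 1 :> int.

(* On an axis, away from the origin, one coordinate is 0 (and sgz 0 = 0), so
   this is the neighbor of x lying one step closer to the origin. *)
Definition toward_origin (x : int * int) : int * int :=
  (x.1 - sgz x.1, x.2 - sgz x.2).

(* The distance |i| to the origin of (i, 0) or (0, i). *)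
Definition axis_dist (x : int * int) : int := `|x.1| + `|x.2|.

Definition trans {R : realType} (alpha : R) (x y : int * int) : R :=
  if ~~ neighbors x y then 0
  else if (x.1 * x.2 != 0) || (x == (0, 0)) then 1 / 4
  else if y == toward_origin x then
    1 - 3 / (4 * (axis_dist x)%:~R `^ alpha)
  else 1 / (4 * (axis_dist x)%:~R `^ alpha).

(* Z^2 carries its discrete sigma-algebra. The last clause is
   P(X_(n+1) = x_(n+1) | X_0 = x_0, ..., X_n = x_n) = trans x_n x_(n+1),
   multiplied out so that conditioning events of probability 0 are harmless. *)
Definition is_chain {R : realType} (alpha : R) {d : measure_display}
    {T : measurableType d} (P : probability T R) (X : nat -> T -> int * int) :
    Prop :=
  [/\ forall (n : nat) (A : set (int * int)), measurable (X n @^-1` A),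
      P [set t | X 0%N t = (1, 1)] = 1%E &
      forall (n : nat) (x : nat -> int * int),
        P [set t | forall i, (i <= n.+1)%N -> X i t = x i] =
        (P [set t | forall i, (i <= n)%N -> X i t = x i] *
         (trans alpha (x n) (x n.+1))%:E)%E].

Definition local_time {R : realType} {T : Type} (X : nat -> T -> int * int)
    (A : set (int * int)) (n : nat) (t : T) : R :=
  \sum_(1 <= i < n.+1) \1_A (X i t).

Definition cvg_in_probability {R : realType} {d : measure_display}
    {T : measurableType d} (P : probability T R) (Y : nat -> T -> R) (c : R) :
    Prop :=
  forall eps : R, 0 < eps ->
    P [set t | eps < `|Y n t - c|] @[n --> \oo] --> 0%E.

(* Main.v *)
Require Import Defs.
From mathcomp Require Import all_boot all_order all_algebra.
From mathcomp Require Import all_classical all_reals all_analysis.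
From mathcomp Require Import ring lra zify.

(** The excursions of the chain away from the axes have lengths with tail of
    order [1 / t], so their mean truncated at [n] is of order [ln n], and about
    [n / ln n] of them fit before time [n]. The proof replaces the tail
    asymptotics by two explicit potentials of the quadrant, seen as functions
    of [(|x|, |y|)]:
    - [area] = [|x y|], which is harmonic off the axes;
    - [clock], a discretization of [Im (z^2 log z)] corrected by [Re (z^2)] and
      [|z|^2] so as to vanish on the axes, whose drift off the axes tends to
      [1] at infinity, and which is [4 / pi * area * ln (x^2 + y^2)] up to a
      multiple of [area].
    Along the chain the expectation of [clock] grows like the elapsed time [m].
    That of [area] grows only when the chain is on an axis, hence, by a renewal
    argument ([ratio_law]), like [K] times the expected number of visits to the
    origin. As the walk is diffusive, [ln (x^2 + y^2)] may be replaced by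
    [ln n] up to an error [o(n)]; comparing the two potentials gives
    [4 / pi * K * ln n * visits m = m + o(n)] uniformly in [m <= n]
    ([visits_growth]), and [ratio_law] transfers this to the time spent on the
    axes ([occupation_growth]).

    The errors (the drift of [clock] near the corner, the time spent on the
    axes) are absorbed by the Lyapunov function [lyap], of linear growth, which
    decreases on average by [1] on the axes away from the origin and by an
    amount of order [|z|^(-3)] elsewhere.

    Convergence in probability follows from Chebyshev's inequality: by the
    Markov property the second moment of a local time is
    [2 * sum_k P(visit at time k) * (mean local time in the last n - k steps)], and
    the uniform estimate of the means bounds it by [(1 + o(1))] times the square
    of the mean ([path_sum_variance]). All of this is about iterates of
    the transition operator; [trajectory_law] connects it with the process. *)

Set Implicit Arguments.
Unset Strict Implicit.
Unset Printing Implicit Defensive.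

Import Order.TTheory GRing.Theory Num.Theory.
Import numFieldNormedType.Exports.

Local Open Scope classical_set_scope.
Local Open Scope ring_scope.

(** * The transition operator *)

Section TransitionOperator.
Variables (R : realType) (alpha : R).
Implicit Types (x : int * int) (g h : int * int -> R).

Definition nbs x : seq (int * int) :=
  [:: (x.1 + 1, x.2); (x.1 - 1, x.2); (x.1, x.2 + 1); (x.1, x.2 - 1)].

Definition step g x : R := \sum_(y <- nbs x) trans alpha x y * g y.

Lemma stepD g h x : step (fun y => g y + h y) x = step g x + step h x.
Proof. by rewrite /step -big_split /=; apply: eq_bigr => y _; rewrite mulrDr. Qed.

Lemma stepB g h x : step (fun y => g y - h y) x = step g x - step h x.
Proof.
by rewrite /step -sumrB; apply: eq_bigr => y _; rewrite mulrBr.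
Qed.

Lemma stepZ c g x : step (fun y => c * g y) x = c * step g x.
Proof. by rewrite /step mulr_sumr; apply: eq_bigr => y _; rewrite mulrCA. Qed.

Lemma step_sum (n : nat) (f : nat -> int * int -> R) x :
  step (fun y => \sum_(i < n) f i y) x = \sum_(i < n) step (f i) x.
Proof.
by rewrite exchange_big; apply: eq_bigr => y _; rewrite mulr_sumr.
Qed.

Lemma eq_step g h : g =1 h -> step g =1 step h.
Proof. by move=> gh x; apply: eq_bigr => y _; rewrite gh. Qed.

(** On an axis at distance [i], the probability of each of the three steps that
    do not lead towards the origin. *)
Definition leave (i : nat) : R := 1 / (4 * i%:R `^ alpha).

Lemma neighbors_nbs x y : y \in nbs x -> neighbors x y.
Proof.
by case: x y => [a b] [c d]; rewrite /neighbors !inE !xpair_eqE /= => H; lia.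
Qed.

Lemma trans_off_nbs x y : y \notin nbs x -> trans alpha x y = 0.
Proof.
move=> H; rewrite /trans ifT //; apply: contra H.
by case: x y => [a b] [c d]; rewrite /neighbors !inE !xpair_eqE /= => H; lia.
Qed.

(** Most functions below depend on the absolute values of the coordinates only,
    symmetrically; this reduces a step of the chain to the three cases
    [step_origin], [step_axis] and [step_bulk]. *)
Definition absfun (u : nat -> nat -> R) x : R := u `|x.1|%N `|x.2|%N.

Lemma absfun_axis (u : nat -> nat -> R) x i : (forall i j, u i j = u j i) ->
  x.1 * x.2 = 0 -> (`|x.1| + `|x.2|)%N = i.+1 -> absfun u x = u i.+1 0%N.
Proof.
move=> us /eqP x0 E; rewrite /absfun.
have [[-> P2]|[-> P1]] :
    (x.1 = 0 /\ `|x.2|%N = i.+1) \/ (x.2 = 0 /\ `|x.1|%N = i.+1).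
- by move: x0; rewrite mulf_eq0; lia.
- by rewrite P2 us.
- by rewrite P1.
Qed.

Lemma step_bulk u x a b : (forall i j, u i j = u j i) ->
  `|x.1|%N = a.+1 -> `|x.2|%N = b.+1 ->
  step (absfun u) x =
    (u a.+2 b.+1 + u a b.+1 + u a.+1 b.+2 + u a.+1 b) / 4.
Proof.
case: x => x1 x2 /= hs E1 E2.
rewrite /step (eq_big_seq (fun y => 1 / 4 * absfun u y)); last first.
  move=> y /neighbors_nbs N; rewrite /trans N /= ifT //.
  by rewrite mulf_neq0 //; lia.
rewrite -mulr_sumr !big_cons big_nil /absfun /= E1 E2.
have [P1|P1] : (0 < x1) \/ (x1 < 0) by lia.
  have -> : (absz (x1 + 1) = a.+2) by lia.
  have -> : (absz (x1 - 1) = a) by lia.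
  have [P2|P2] : (0 < x2) \/ (x2 < 0) by lia.
    have -> : (absz (x2 + 1) = b.+2) by lia.
    have -> : (absz (x2 - 1) = b) by lia.
    by field.
  have -> : (absz (x2 - 1) = b.+2) by lia.
  have -> : (absz (x2 + 1) = b) by lia.
  by field.
have -> : (absz (x1 - 1) = a.+2) by lia.
have -> : (absz (x1 + 1) = a) by lia.
have [P2|P2] : (0 < x2) \/ (x2 < 0) by lia.
  have -> : (absz (x2 + 1) = b.+2) by lia.
  have -> : (absz (x2 - 1) = b) by lia.
  by field.
have -> : (absz (x2 - 1) = b.+2) by lia.
have -> : (absz (x2 + 1) = b) by lia.
by field.
Qed.

Lemma step_origin u : (forall i j, u i j = u j i) ->
  step (absfun u) (0, 0) = u 1%N 0%N.
Proof.
move=> hs.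
rewrite /step (eq_big_seq (fun y => 1 / 4 * absfun u y)); last first.
  by move=> y /neighbors_nbs N; rewrite /trans N.
rewrite -mulr_sumr !big_cons big_nil /absfun /= (hs 0%N 1%N).
by field.
Qed.

Lemma step_axis u x i : (forall i j, u i j = u j i) ->
  x.1 * x.2 = 0 -> (`|x.1| + `|x.2|)%N = i.+1 ->
  step (absfun u) x = (1 - 3 * leave i.+1) * u i 0%N
    + leave i.+1 * (u i.+2 0%N + 2 * u i.+1 1%N).
Proof.
case: x => x1 x2 /= hs /eqP x0 E.
have D : axis_dist (x1, x2) = i.+1 :> int by rewrite /axis_dist /=; lia.
have x00 : ((x1, x2) == (0, 0)) = false by rewrite xpair_eqE; lia.
rewrite /step !big_cons big_nil /trans !neighbors_nbs ?inE ?eqxx ?orbT //=.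
rewrite x0 x00 /= D -pmulrn.
have -> : 3 / (4 * i.+1%:R `^ alpha) = 3 * leave i.+1.
  by rewrite /leave mul1r.
rewrite -/(leave i.+1) /toward_origin /= !xpair_eqE /absfun /=.
have [[-> P]|[-> P]] : (x1 = 0 /\ `|x2|%N = i.+1) \/ (x2 = 0 /\ `|x1|%N = i.+1).
- by move: x0; rewrite mulf_eq0; lia.
- rewrite sgz0 subr0 eqxx /= -[(0 + 1)%N]/1%N -[(0 - 0).+1]/1%N.
  have [P2|P2] : (0 < x2) \/ (x2 < 0) by lia.
    rewrite gtr0_sgz // eqxx.
    have -> : (x2 + 1 == x2 - 1) = false by lia.
    rewrite /=.
    have -> : (absz (x2 + 1) = i.+2) by lia.
    have -> : (absz (x2 - 1) = i) by lia.
    have -> : (`|x2|%N = i.+1) by lia.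
    by rewrite (hs 0%N i) (hs 0%N i.+2) (hs 1%N i.+1); ring.
  rewrite ltr0_sgz // opprK eqxx.
  have -> : (x2 - 1 == x2 + 1) = false by lia.
  rewrite /=.
  have -> : (absz (x2 - 1) = i.+2) by lia.
  have -> : (absz (x2 + 1) = i) by lia.
  have -> : (`|x2|%N = i.+1) by lia.
  by rewrite (hs 0%N i) (hs 0%N i.+2) (hs 1%N i.+1); ring.
- rewrite sgz0 subr0 eqxx /=.
  have -> : (0 + 1 == 0 :> int) = false by [].
  have -> : (0 - 1 == 0 :> int) = false by [].
  have [P2|P2] : (0 < x1) \/ (x1 < 0) by lia.
    rewrite gtr0_sgz // eqxx.
    have -> : (x1 + 1 == x1 - 1) = false by lia.
    rewrite /= !andbF.
    have -> : (absz (x1 + 1) = i.+2) by lia.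
    have -> : (absz (x1 - 1) = i) by lia.
    have -> : (`|x1|%N = i.+1) by lia.
    by ring.
  rewrite ltr0_sgz // opprK eqxx.
  have -> : (x1 - 1 == x1 + 1) = false by lia.
  rewrite /= !andbF.
  have -> : (absz (x1 - 1) = i.+2) by lia.
  have -> : (absz (x1 + 1) = i) by lia.
  have -> : (`|x1|%N = i.+1) by lia.
  by ring.
Qed.

Variant position x : Prop :=
| AtOrigin of x = (0, 0)
| OnAxis i of x.1 * x.2 = 0 & (`|x.1| + `|x.2|)%N = i.+1 & x <> (0, 0)
| InBulk a b of `|x.1|%N = a.+1 & `|x.2|%N = b.+1 & x.1 * x.2 <> 0
    & x <> (0, 0).

Lemma positionP x : position x.
Proof.
case: x => x1 x2.
case: (eqVneq (x1, x2) (0, 0)) => [->|ne]; first exact: AtOrigin.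
have ne' := elimN eqP ne.
case: (eqVneq (x1 * x2) 0) => [e|ne2].
  apply: (@OnAxis _ (`|x1| + `|x2|)%N.-1) => //=.
  by move: ne; rewrite xpair_eqE; lia.
apply: (@InBulk _ `|x1|%N.-1 `|x2|%N.-1) => //=; last exact/eqP.
  by move: ne2; rewrite mulf_eq0; lia.
by move: ne2; rewrite mulf_eq0; lia.
Qed.

Hypothesis alpha3 : 3 < alpha.

Lemma leave_gt0 i : 0 < leave i.+1.
Proof. by rewrite /leave divr_gt0 // mulr_gt0 // powR_gt0. Qed.

Lemma leave_cube i : leave i.+1 * i.+1%:R ^+ 3 <= 1 / 4.
Proof.
have h : i.+1%:R ^+ 3 <= i.+1%:R `^ alpha :> R.
  by rewrite -powR_mulrn // ler_powR ?ler1n // ltW.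
have p : 0 < i.+1%:R `^ alpha :> R by rewrite powR_gt0.
rewrite /leave mul1r ler_pdivrMl ?mulr_gt0 //.
by lra.
Qed.

Lemma leave_le4 i : leave i.+1 <= 1 / 4.
Proof.
apply: le_trans (leave_cube i).
by rewrite ler_peMr ?(ltW (leave_gt0 _)) // exprn_ege1 // ler1n.
Qed.

Lemma leave1 : leave 1 = 1 / 4.
Proof. by rewrite /leave powR1 mulr1. Qed.

Lemma leave_ge2 i : leave i.+2 <= 1 / 32.
Proof.
have := leave_cube i.+1; have := leave_gt0 i.+1.
have : 8 <= i.+2%:R ^+ 3 :> R.
  have -> : 8 = 2%:R ^+ 3 :> R by ring.
  by rewrite lerXn2r ?nnegrE // ler_nat.
by nra.
Qed.

Lemma trans_ge0 x y : 0 <= trans alpha x y.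
Proof.
rewrite /trans; case: ifP => // _; case: ifP => [_|/negbT]; first by lra.
rewrite negb_or negbK => /andP[/eqP x0 /eqP ne].
have [e|i _ E _|a b] := positionP x; [by []| |by []].
have -> : axis_dist x = i.+1 :> int by rewrite /axis_dist; lia.
rewrite -pmulrn.
have -> : 3 / (4 * i.+1%:R `^ alpha) = 3 * leave i.+1.
  by rewrite /leave mul1r.
by rewrite -/(leave i.+1); have := leave_gt0 i; have := leave_le4 i; case: ifP; lra.
Qed.

Lemma step_cst c x : step (fun=> c) x = c.
Proof.
have hs : forall i j : nat, (fun _ _ => c) i j = (fun _ _ => c) j i by [].
rewrite -[step _ x]/(step (absfun (fun _ _ => c)) x).
have [->|i x0 E _|a b E1 E2 _ _] := positionP x.
- by rewrite step_origin.
- by rewrite (@step_axis (fun _ _ => c) x i hs x0 E); ring.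
- by rewrite (@step_bulk (fun _ _ => c) x a b hs E1 E2); field.
Qed.

Lemma le_step g h x : (forall y, g y <= h y) -> step g x <= step h x.
Proof.
by move=> gh; apply: ler_sum => y _; rewrite ler_wpM2l ?trans_ge0.
Qed.

Lemma step_ge0 g x : (forall y, 0 <= g y) -> 0 <= step g x.
Proof. by move=> g0; rewrite -(step_cst 0 x); exact: le_step. Qed.

End TransitionOperator.

(** * The potential r^2 log r of the quadrant *)

Section QuadrantPotential.
Variable R : realType.
Implicit Types (f g : R -> R) (a b t x y : R).

Lemma is_derive_plus f g t a b : is_derive t 1 f a -> is_derive t 1 g b ->
  is_derive t 1 (fun s => f s + g s) (a + b).
Proof. by move=> df dg; exact: is_deriveD. Qed.

Lemma is_derive_times f g t a b : is_derive t 1 f a -> is_derive t 1 g b ->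
  is_derive t 1 (fun s => f s * g s) (f t * b + g t * a).
Proof. by move=> df dg; exact: is_deriveM. Qed.

Lemma mvt f df a b : a <= b ->
  (forall t, a <= t <= b -> is_derive t 1 f (df t)) ->
  exists2 c, a <= c <= b & f b - f a = df c * (b - a).
Proof.
move=> ab fD.
have [| |c] := @MVT_segment R f df a b ab.
- move=> t; rewrite in_itv /= => /andP[at_ tb].
  by apply: fD; rewrite !ltW.
- apply: derivable_within_continuous => t; rewrite in_itv /= => tab.
  by have [] := fD t tab.
- by rewrite in_itv /= => cab e; exists c.
Qed.

Lemma atan_lipschitz x y : `|atan x - atan y| <= `|x - y|.
Proof.
wlog xy : x y / y <= x.
  move=> H; have [/H//|/ltW/H] := leP y x.
  by rewrite distrC (distrC x y).
have [c _ ->] := mvt xy (fun t _ => is_derive1_atan t).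
rewrite normrM ler_piMl // ger0_norm ?invr_ge0 ?addr_ge0 ?sqr_ge0 //.
by rewrite invf_le1 ?lerDl ?sqr_ge0 // ltr_pwDl // sqr_ge0.
Qed.

(** The polar angle minus [pi / 4], in a form that has no singularity on the
    closed quadrant away from the corner. *)
Definition angle x y : R := atan ((y - x) / (x + y)).

Lemma angleC x y : angle y x = - angle x y.
Proof. by rewrite /angle -atanN -mulNr opprB (addrC y). Qed.

Lemma angle_lipschitz x t y : 0 <= t -> 0 <= x -> 0 < y ->
  `|angle t y - angle x y| <= 2 * `|t - x| / (x + y).
Proof.
move=> t0 x0 y0; apply: le_trans (atan_lipschitz _ _) _.
have ty : 0 < t + y by rewrite ltr_wpDl.
have xy : 0 < x + y by rewrite ltr_wpDl.
have -> : (y - t) / (t + y) - (y - x) / (x + y) =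
    (2 * (x - t) / (x + y)) * (y / (t + y)).
  by field; rewrite !gt_eqF.
rewrite normrM [X in X * _]normrM [X in X * _ * _]normrM (distrC x).
rewrite (ger0_norm (ler0n _ 2)) (gtr0_norm (_ : 0 < (x + y)^-1)) ?invr_gt0 //.
rewrite ler_piMr ?divr_ge0 ?mulr_ge0 ?(ltW xy) //.
by rewrite ger0_norm ?divr_ge0 ?(ltW ty) ?(ltW y0) // ler_pdivrMr // mul1r lerDr.
Qed.

(** With [z = x + i y] this is [Im (z^2 log z) - pi / 4 * Re (z^2)], the second
    term turning the polar angle into [angle]. *)
Definition logpot x y : R :=
  x * y * ln (x ^+ 2 + y ^+ 2) + (x ^+ 2 - y ^+ 2) * angle x y.

Lemma logpotC x y : logpot x y = logpot y x.
Proof.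
rewrite /logpot (angleC x y) (addrC (y ^+ 2)); ring.
Qed.

Lemma is_derive_angle t y : 0 <= t -> 0 < y ->
  is_derive t 1 (angle ^~ y) (- y / (t ^+ 2 + y ^+ 2)).
Proof.
move=> t0 y0; have ty : 0 < t + y by rewrite ltr_wpDl.
have dn : is_derive t 1 (fun s : R => y - s) (0 + - 1).
  exact: is_derive_plus.
have dd : is_derive t 1 (fun s : R => s + y) (1 + 0).
  exact: is_derive_plus.
have dV : is_derive t 1 (fun s : R => (s + y)^-1) (- (t + y) ^- 2 *: (1 + 0)).
  by apply: is_deriveV; rewrite ?gt_eqF.
have dq := is_derive_times dn dV.
have := @is_derive1_comp _ _ (fun s => (y - s) / (s + y)) t _ _
  (is_derive1_atan _) dq.
move=> /is_derive_eq; apply.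
rewrite /GRing.scale /=; field.
have sq : 0 < t ^+ 2 + y ^+ 2 by rewrite ltr_wpDl ?sqr_ge0 // exprn_gt0.
by rewrite !gt_eqF //; nra.
Qed.

Lemma is_derive_logpot t y : 0 <= t -> 0 < y ->
  is_derive t 1 (logpot ^~ y)
    (y * ln (t ^+ 2 + y ^+ 2) + 2 * t * angle t y + y).
Proof.
move=> t0 y0.
have sq : 0 < t ^+ 2 + y ^+ 2 by rewrite ltr_wpDl ?sqr_ge0 // exprn_gt0.
have d2 : is_derive t 1 (fun s : R => s ^+ 2) (2 * t).
  by apply: is_derive_eq; rewrite /GRing.scale /=; ring.
have d2p : is_derive t 1 (fun s : R => s ^+ 2 + y ^+ 2) (2 * t + 0).
  exact: is_derive_plus.
have d2m : is_derive t 1 (fun s : R => s ^+ 2 - y ^+ 2) (2 * t + 0).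
  exact: is_derive_plus.
have dln := @is_derive1_comp _ _ (fun s => s ^+ 2 + y ^+ 2) t _ _
  (is_derive1_ln sq) d2p.
have dxy : is_derive t 1 (fun s : R => s * y) (t * 0 + y * 1).
  exact: is_derive_times.
have := is_derive_plus (is_derive_times dxy dln)
  (is_derive_times d2m (is_derive_angle t0 y0)).
move=> /is_derive_eq; apply.
by rewrite /=; field; rewrite gt_eqF.
Qed.

Lemma is_derive2_logpot t y : 0 <= t -> 0 < y ->
  is_derive t 1 (fun t => y * ln (t ^+ 2 + y ^+ 2) + 2 * t * angle t y + y)
    (2 * angle t y).
Proof.
move=> t0 y0.
have sq : 0 < t ^+ 2 + y ^+ 2 by rewrite ltr_wpDl ?sqr_ge0 // exprn_gt0.
have d2 : is_derive t 1 (fun s : R => s ^+ 2) (2 * t).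
  by apply: is_derive_eq; rewrite /GRing.scale /=; ring.
have d2p : is_derive t 1 (fun s : R => s ^+ 2 + y ^+ 2) (2 * t + 0).
  exact: is_derive_plus.
have dln := @is_derive1_comp _ _ (fun s => s ^+ 2 + y ^+ 2) t _ _
  (is_derive1_ln sq) d2p.
have dl : is_derive t 1 (fun s : R => 2 * s) (2 * 1 + t * 0).
  exact: is_derive_times.
have dyl : is_derive t 1 (fun s : R => y * ln (s ^+ 2 + y ^+ 2))
   (y * ((t ^+ 2 + y ^+ 2)^-1 * (2 * t + 0)) + ln (t ^+ 2 + y ^+ 2) * 0).
  exact: is_derive_times.
have := is_derive_plus (is_derive_plus dyl
  (is_derive_times dl (is_derive_angle t0 y0))) (is_derive_cst y t 1).
move=> /is_derive_eq; apply.
by rewrite /=; field; rewrite gt_eqF.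
Qed.

(** The second derivative of [logpot] in its first variable is [2 * angle], and
    [angle] has oscillation of order [1 / (x + y)] over one lattice step. *)
Lemma logpot_second_difference x y : 1 <= x -> 1 <= y ->
  `|logpot (x + 1) y + logpot (x - 1) y - 2 * logpot x y - 2 * angle x y|
     <= 8 / (x + y).
Proof.
move=> x1 y1; have y0 : 0 < y by lra.
pose H t := logpot t y - angle x y * t ^+ 2.
pose dH t := y * ln (t ^+ 2 + y ^+ 2) + 2 * t * angle t y + y
              - 2 * angle x y * t.
have d2 t : is_derive t 1 (fun s : R => - angle x y * s ^+ 2)
    (- 2 * angle x y * t).
  by apply: is_derive_eq; rewrite /GRing.scale /=; ring.
have d1 t : is_derive t 1 (fun s : R => - 2 * angle x y * s)
    (- 2 * angle x y).
  by apply: is_derive_eq; rewrite /GRing.scale /=; ring.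
have HD t : 0 <= t -> is_derive t 1 H (dH t).
  move=> t0; have := is_derive_plus (is_derive_logpot t0 y0) (d2 t).
  have -> : (fun s => logpot s y + - angle x y * s ^+ 2) = H.
    by apply/funext => s; rewrite /H mulNr.
  by move=> /is_derive_eq; apply; rewrite /dH; ring.
have dHD t : 0 <= t -> is_derive t 1 dH (2 * angle t y - 2 * angle x y).
  move=> t0; have := is_derive_plus (is_derive2_logpot t0 y0) (d1 t).
  have -> : (fun s => y * ln (s ^+ 2 + y ^+ 2) + 2 * s * angle s y + y
       + - 2 * angle x y * s) = dH by apply/funext => s; rewrite /dH; ring.
  by move=> /is_derive_eq; apply; ring.
have mvt0 (f df : R -> R) a b : 0 <= a -> a <= b ->
    (forall t, 0 <= t -> is_derive t 1 f (df t)) ->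
    exists2 c, a <= c <= b & f b - f a = df c * (b - a).
  move=> a0 ab fD; apply: (mvt ab) => t /andP[at_ _].
  by apply: fD; exact: le_trans at_.
have [||u /andP[ul ur] eu] := mvt0 H dH x (x + 1) _ _ HD; [lra|lra|].
have [||v /andP[vl vr] ev] := mvt0 H dH (x - 1) x _ _ HD; [lra|lra|].
have [||w /andP[wl wr] ew] := mvt0 dH _ v u _ _ dHD; [lra|lra|].
have -> : logpot (x + 1) y + logpot (x - 1) y - 2 * logpot x y - 2 * angle x y
   = (2 * angle w y - 2 * angle x y) * (u - v).
  rewrite -ew; have -> : dH u = H (x + 1) - H x by rewrite eu; ring.
  have -> : dH v = H x - H (x - 1) by rewrite ev; ring.
  by rewrite /H; ring.
have w0 : 0 <= w by lra.
have x0 : 0 <= x by lra.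
have xy : 0 < (x + y)^-1 by rewrite invr_gt0; lra.
rewrite -mulrBr !normrM (ger0_norm (ler0n _ 2)).
have uv : `|u - v| <= 2 by rewrite ler_norml; lra.
have wx : `|w - x| <= 1 by rewrite ler_norml; lra.
have A : `|angle w y - angle x y| <= 2 / (x + y).
  apply: le_trans (angle_lipschitz w0 x0 y0) _.
  by rewrite ler_wpM2r ?(ltW xy) // ler_piMr.
have -> : 8 / (x + y) = 2 * (2 / (x + y)) * 2 by ring.
by apply: ler_pM => //; rewrite ?mulr_ge0 // ler_wpM2l.
Qed.

(** It vanishes on the axes and a quarter of its Laplacian is [1]: minus the
    expected exit time of the walk from the quadrant, which is infinite, made
    finite by adding an infinite multiple of the harmonic function [x * y]. *)
Definition timepot x y : R := x ^+ 2 + y ^+ 2 + 4 / pi * logpot x y.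

Lemma timepotC x y : timepot x y = timepot y x.
Proof. by rewrite /timepot logpotC (addrC (x ^+ 2)). Qed.

Lemma pi_neq0 : (pi : R) != 0.
Proof. by rewrite gt_eqF ?pi_gt0. Qed.

Lemma pi_inv_bounds : 0 < (pi : R)^-1 <= 2^-1.
Proof.
by rewrite invr_gt0 pi_gt0 lef_pV2 ?posrE ?pi_gt0 ?pi_ge2.
Qed.

(** The two second derivatives of [logpot] are opposite, so only [x^2 + y^2]
    contributes to the mean over the neighbours. *)
Lemma timepot_laplacian x y : 1 <= x -> 1 <= y ->
  `|(timepot (x + 1) y + timepot (x - 1) y + timepot x (y + 1)
      + timepot x (y - 1)) / 4 - timepot x y - 1| <= 8 / (x + y).
Proof.
move=> x1 y1; have Dx := logpot_second_difference x1 y1.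
have := logpot_second_difference y1 x1.
rewrite (angleC x y) (addrC y x) !(logpotC _ x) => Dy.
have /andP[p0 p2] := pi_inv_bounds.
have -> : (timepot (x + 1) y + timepot (x - 1) y + timepot x (y + 1)
      + timepot x (y - 1)) / 4 - timepot x y - 1 =
  pi^-1 * (logpot (x + 1) y + logpot (x - 1) y - 2 * logpot x y - 2 * angle x y)
  + pi^-1 * (logpot x (y + 1) + logpot x (y - 1) - 2 * logpot x y
             - 2 * - angle x y).
  by rewrite /timepot; have := pi_neq0; move: (pi : R) => p pn; field.
set e := 8 / (x + y) in Dx Dy *.
have e0 : 0 <= e by apply: le_trans Dx.
apply: le_trans (ler_normD _ _) _.
rewrite !normrM (gtr0_norm p0).
by nra.
Qed.

(** When [y <= x] the difference is
    [x^2 + y^2 - (4/pi) (x^2 - y^2) (pi/4 - theta)], where the polar angle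
    [theta] is at most of order [y / x]. *)
Lemma timepot_log x y : 0 <= x -> 0 <= y ->
  0 <= timepot x y - 4 / pi * (x * y * ln (x ^+ 2 + y ^+ 2)) <= 6 * (x * y).
Proof.
wlog xy : x y / y <= x.
  move=> H x0 y0; have [/H|/ltW/H] := leP y x; first exact.
  by rewrite timepotC (addrC (y ^+ 2)) (mulrC y); apply.
move=> x0 y0.
have -> : timepot x y - 4 / pi * (x * y * ln (x ^+ 2 + y ^+ 2)) =
   x ^+ 2 + y ^+ 2 - 4 / pi * ((x ^+ 2 - y ^+ 2) * - angle x y).
  by rewrite /timepot /logpot; ring.
rewrite -angleC /angle.
have [s0|s0] := leP (y + x) 0.
  have -> : x = 0 by lra.
  have -> : y = 0 by lra.
  by rewrite !(subrr, mul0r, mulr0, addr0, expr0n) /= lexx.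
set u := (x - y) / (y + x).
have u0 : 0 <= u by rewrite divr_ge0 ?subr_ge0 // ltW.
have u1 : 1 - u = 2 * y / (y + x) by rewrite /u; field; rewrite gt_eqF.
have u1' : 0 <= 1 - u by rewrite u1 divr_ge0 ?mulr_ge0 // ltW.
have a1 : atan u <= pi / 4 by rewrite -atan1; apply: le_atan; lra.
have a2 : pi / 4 - (1 - u) <= atan u.
  have := atan_lipschitz 1 u; rewrite atan1 (ger0_norm u1').
  by rewrite ger0_norm ?subr_ge0 // -?atan1 ?le_atan //; lra.
have /andP[p0 p2] := pi_inv_bounds.
have q0 : 0 <= x ^+ 2 - y ^+ 2 by nra.
have b1 : 4 / pi * ((x ^+ 2 - y ^+ 2) * atan u) <= x ^+ 2 - y ^+ 2.
  have -> : x ^+ 2 - y ^+ 2 = 4 / pi * ((x ^+ 2 - y ^+ 2) * (pi / 4)).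
    by have := pi_neq0; move: (pi : R) => p pn; field.
  rewrite ler_wpM2l ?mulr_ge0 ?(ltW p0) //.
  rewrite [X in X * atan u](_ : _ = x ^+ 2 - y ^+ 2) ?ler_wpM2l //.
  by have := pi_neq0; move: (pi : R) => p pn; field.
have b2 : x ^+ 2 - y ^+ 2 - 4 / pi * ((x ^+ 2 - y ^+ 2) * (1 - u))
    <= 4 / pi * ((x ^+ 2 - y ^+ 2) * atan u).
  have -> : x ^+ 2 - y ^+ 2 - 4 / pi * ((x ^+ 2 - y ^+ 2) * (1 - u)) =
     4 / pi * ((x ^+ 2 - y ^+ 2) * (pi / 4 - (1 - u))).
    by have := pi_neq0; move: (pi : R) => p pn; field.
  by rewrite ler_wpM2l ?mulr_ge0 ?(ltW p0) // ler_wpM2l.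
have b3 : (x ^+ 2 - y ^+ 2) * (1 - u) = 2 * (x - y) * y.
  by rewrite u1; field; rewrite gt_eqF.
rewrite b3 in b2.
apply/andP; split; first by nra.
have b4 : 4 / pi * (2 * (x - y) * y) <= 4 * (x - y) * y.
  have -> : 4 / pi * (2 * (x - y) * y) = 8 * ((x - y) * y) * pi^-1 by ring.
  have -> : 4 * (x - y) * y = 8 * ((x - y) * y) * 2^-1 by field.
  by rewrite ler_wpM2l // mulr_ge0 // mulr_ge0 // subr_ge0.
by nra.
Qed.

Lemma timepot0 x : 0 <= x -> timepot x 0 = 0.
Proof.
move=> x0; have := timepot_log x0 (lexx 0).
by rewrite !(mulr0, mul0r) subr0 => H; apply/eqP; rewrite eq_le andbC.
Qed.

End QuadrantPotential.

(** * Iterates of the transition operator *)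

Section Iterates.
Variables (R : realType) (alpha : R).
Hypothesis alpha3 : 3 < alpha.
Implicit Types (x : int * int) (f g : int * int -> R) (n : nat).

Local Notation P := (step alpha).

Definition expect n g : int * int -> R := iter n P g.

Definition occupation n g x : R := \sum_(k < n) expect k g x.

Lemma expectS n g x : expect n.+1 g x = P (expect n g) x.
Proof. by []. Qed.

Lemma expect_step n g x : expect n (P g) x = P (expect n g) x.
Proof. by rewrite /expect -iterSr. Qed.

Lemma expectD n f g x :
  expect n (fun y => f y + g y) x = expect n f x + expect n g x.
Proof.
elim: n x => // n IH x; rewrite !expectS -stepD; exact: eq_step.
Qed.

Lemma expectZ n c g x : expect n (fun y => c * g y) x = c * expect n g x.
Proof.
elim: n x => // n IH x; rewrite !expectS -stepZ; exact: eq_step.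
Qed.

Lemma expectB n f g x :
  expect n (fun y => f y - g y) x = expect n f x - expect n g x.
Proof.
elim: n x => // n IH x; rewrite !expectS -stepB; exact: eq_step.
Qed.

Lemma expect_cst n c x : expect n (fun=> c) x = c.
Proof.
elim: n x => // n IH x; rewrite expectS -[RHS](step_cst alpha c x).
exact: eq_step.
Qed.

Lemma le_expect n f g x : (forall y, f y <= g y) -> expect n f x <= expect n g x.
Proof.
move=> fg; elim: n x => [|n IH] x; first exact: fg.
by rewrite !expectS; exact: le_step.
Qed.

Lemma expect_ge0 n g x : (forall y, 0 <= g y) -> 0 <= expect n g x.
Proof. by move=> g0; rewrite -(expect_cst n 0 x); exact: le_expect. Qed.

Lemma ler_norm_expect n g x : `|expect n g x| <= expect n (fun y => `|g y|) x.
Proof.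
rewrite ler_norml -mulN1r -expectZ; apply/andP; split.
  by apply: le_expect => y; rewrite mulN1r lerNl -normrN ler_norm.
by apply: le_expect => y; exact: ler_norm.
Qed.

Lemma occupationD n f g x :
  occupation n (fun y => f y + g y) x = occupation n f x + occupation n g x.
Proof. by rewrite -big_split; apply: eq_bigr => k _; exact: expectD. Qed.

Lemma occupationZ n c g x :
  occupation n (fun y => c * g y) x = c * occupation n g x.
Proof. by rewrite mulr_sumr; apply: eq_bigr => k _; exact: expectZ. Qed.

Lemma le_occupation n f g x : (forall y, f y <= g y) ->
  occupation n f x <= occupation n g x.
Proof. by move=> fg; apply: ler_sum => k _; exact: le_expect. Qed.

Lemma occupation_ge0 n g x : (forall y, 0 <= g y) -> 0 <= occupation n g x.
Proof. by move=> g0; apply: sumr_ge0 => k _; exact: expect_ge0. Qed.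

Lemma occupationS n g x :
  occupation n.+1 g x = g x + P (occupation n g) x.
Proof.
rewrite /occupation big_ord_recl; congr (_ + _).
by rewrite step_sum.
Qed.

Lemma occupation_mono m n g x : (forall y, 0 <= g y) -> (m <= n)%N ->
  occupation m g x <= occupation n g x.
Proof.
move=> g0 /subnK <-; elim: (n - m)%N => // k IH.
apply: le_trans IH _; rewrite addSn /occupation big_ord_recr /= lerDl.
exact: expect_ge0.
Qed.

(** Dynkin's formula. *)
Lemma expect_drift n g x :
  expect n g x = g x + occupation n (fun y => P g y - g y) x.
Proof.
elim: n => [|n IH]; first by rewrite /occupation big_ord0 addr0.
rewrite /occupation big_ord_recr /= -/(occupation _ _ _) addrA -IH.
by rewrite expectB expect_step; ring.
Qed.

End Iterates.

Arguments absfun : simpl never.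

(** * Lyapunov functions *)

Section Lyapunov.
Variables (R : realType) (alpha : R).
Hypothesis alpha3 : 3 < alpha.
Implicit Types (x : int * int) (f g : int * int -> R) (n : nat).

Local Notation P := (step alpha).
Local Notation expect := (expect alpha).
Local Notation occupation := (occupation alpha).

Definition origin x : R := (x == (0, 0))%:R.
Definition axis x : R := (x.1 * x.2 == 0)%:R.
Definition visits n x : R := occupation n origin x.

Definition norm1 : int * int -> R := absfun (fun i j => (i + j)%:R).
Definition sqnorm : int * int -> R :=
  absfun (fun i j => i%:R ^+ 2 + j%:R ^+ 2).

Lemma norm1_ge0 x : 0 <= norm1 x.
Proof. exact: ler0n. Qed.

Lemma sqnorm_ge0 x : 0 <= sqnorm x.
Proof. by rewrite addr_ge0 ?sqr_ge0. Qed.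

Lemma norm1_sq x : norm1 x ^+ 2 <= 2 * sqnorm x.
Proof.
rewrite /norm1 /sqnorm /absfun natrD.
by have := sqr_ge0 (`|x.1|%N%:R - `|x.2|%N%:R : R); nra.
Qed.

(** The linear part is harmonic off the axes and decreases on them, except at the
    four neighbours of the origin, where the jump [8 * (0 < i + j)] compensates
    its increase. The last summand is concave in [i + j], which makes the drift
    strictly negative off the axes as well. *)
Definition lyap : int * int -> R :=
  absfun (fun i j => 2 * (i + j)%:R + 8 * (0 < i + j)%N%:R
                   + (i + j)%:R / (i + j).+1%:R).

(** A lower bound for the decrease of [lyap] off the origin; off the axes it is
    the second difference of the fraction [s / (s + 1)]. *)
Definition rare x : R :=
  if x.1 * x.2 == 0 then 1
  else (norm1 x * (norm1 x + 1) * (norm1 x + 2))^-1.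

Lemma frac_bounds (i : nat) : 0 <= (i%:R / i.+1%:R : R) <= 1.
Proof. by rewrite divr_ge0 // ler_pdivrMr // mul1r ler_nat leqnSn. Qed.

Lemma lyap_ge0 x : 0 <= lyap x.
Proof.
rewrite /lyap /absfun; set i := (_ + _)%N; have /andP[f0 _] := frac_bounds i.
by rewrite !addr_ge0 // mulr_ge0.
Qed.

Lemma lyap_le x : lyap x <= 2 * norm1 x + 9.
Proof.
rewrite /lyap /norm1 /absfun; set i := (_ + _)%N.
have /andP[_] := frac_bounds i; move: (_ / _) => q q1.
by case: (0 < i)%N => /=; lra.
Qed.

Lemma lyap_origin : lyap (0, 0) = 0.
Proof. by rewrite /lyap /absfun /= !(mulr0, mul0r, addr0). Qed.

(** At the origin [P lyap] equals [2 + 8 + 1 / 2], whence the constant [12]. *)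
Lemma lyap_drift x : P lyap x - lyap x <= - rare x + 12 * origin x.
Proof.
have hs : forall i j : nat,
  2 * (i + j)%:R + 8 * (0 < i + j)%N%:R + (i + j)%:R / (i + j).+1%:R =
  2 * (j + i)%:R + 8 * (0 < j + i)%N%:R + (j + i)%:R / (j + i).+1%:R :> R.
  by move=> i j; rewrite addnC.
have [->|i x0 E ne|a b E1 E2 x0 ne] := positionP x.
- rewrite /lyap step_origin // /origin /rare /absfun /=.
  by rewrite !addn0 !(mulr0, mul0r, addr0, subr0); lra.
- rewrite /lyap (step_axis alpha hs x0 E) (absfun_axis hs x0 E) /origin /rare.
  rewrite x0 eqxx (introF eqP ne) mulr0 addr0 !addn0 !addn1.
  case: i E => [|i] _.
    by rewrite leave1 /=; lra.
  have l0 := leave_gt0 alpha i.+1; have l2 := leave_ge2 alpha3 i.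
  rewrite !ltn0Sn.
  set l := leave _ _ in l0 l2 *.
  have i0 : 0 <= i%:R :> R by [].
  rewrite -![i.+4]addn4 -![i.+3]addn3 -![i.+2]addn2 -![i.+1]addn1 !natrD.
  move: (i%:R : R) i0 => t t0.
  have e21 : (t + 2%:R) / (t + 3%:R) - (t + 1%:R) / (t + 2%:R) =
      ((t + 2%:R) * (t + 3%:R))^-1 by field; rewrite !gt_eqF //; lra.
  have e32 : (t + 3%:R) / (t + 4%:R) - (t + 2%:R) / (t + 3%:R) =
      ((t + 3%:R) * (t + 4%:R))^-1 by field; rewrite !gt_eqF //; lra.
  have a1 : 0 <= ((t + 2%:R) * (t + 3%:R))^-1.
    by rewrite invr_ge0 mulr_ge0 //; lra.
  have a2 : ((t + 3%:R) * (t + 4%:R))^-1 <= ((t + 2%:R) * (t + 3%:R))^-1.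
    by rewrite lef_pV2 ?posrE; nra.
  rewrite -e32 -!e21 in a1 a2.
  move: ((t + 1%:R) / (t + 2%:R)) ((t + 2%:R) / (t + 3%:R))
    ((t + 3%:R) / (t + 4%:R)) a1 a2 {e21 e32} => q1 q2 q3 a1 a2.
  have b1 : 0 <= l * ((q2 - q1) - (q3 - q2)).
    by rewrite mulr_ge0 ?subr_ge0 // ltW.
  have b2 : 0 <= (1 - 6 * l) * (q2 - q1) by rewrite mulr_ge0 //; lra.
  by rewrite /=; lra.
- rewrite /lyap (step_bulk alpha hs E1 E2) /origin /rare (introF eqP ne) /absfun.
  rewrite /norm1 /absfun (introF eqP x0) mulr0 addr0 E1 E2.
  rewrite !(addSn, addnS) !ltn0Sn.
  move: (a + b)%N => m; have m0 : 0 <= m%:R :> R by [].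
  rewrite -![m.+4]addn4 -![m.+3]addn3 -![m.+2]addn2 -![m.+1]addn1 !natrD.
  move: (m%:R : R) m0 => t t0.
  rewrite le_eqVlt; apply/orP; left; apply/eqP.
  by field; rewrite !gt_eqF //; lra.
Qed.

Lemma rare_ge0 x : 0 <= rare x.
Proof.
rewrite /rare; case: ifP => // _; have := norm1_ge0 x => s0.
by rewrite invr_ge0 !mulr_ge0 //; lra.
Qed.

Lemma axis_le_rare x : axis x <= rare x.
Proof.
have := rare_ge0 x; rewrite /axis /rare; case: ifP => //=.
Qed.

Lemma origin_le_axis x : origin x <= axis x.
Proof.
by rewrite /origin /axis; case: eqP => [->|_]; rewrite ?eqxx ?ler0n.
Qed.

(** [lyap] stays nonnegative, so its decreases are paid for by its increases,
    which occur at the origin only. *)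
Lemma rare_occupation n x : occupation n rare x <= lyap x + 12 * visits n x.
Proof.
have : 0 <= lyap x + occupation n (fun y => - 1 * rare y + 12 * origin y) x.
  apply: le_trans (expect_ge0 alpha3 n x lyap_ge0) _.
  rewrite expect_drift lerD2l; apply: le_occupation => // y.
  by rewrite mulN1r; exact: lyap_drift.
by rewrite occupationD !occupationZ /visits; lra.
Qed.

(** Until the origin is reached, [lyap] pays for the visits to the axes; after
    that, the chain is one started from the origin, with less time left. *)
Lemma occupation_from n g x : (forall y, 0 <= g y <= axis y) ->
  occupation n g x <= lyap x + occupation n g (0, 0).
Proof.
move=> gb; have g0 y : 0 <= g y by have /andP[] := gb y.
elim: n x => [|n IH] x.
  by rewrite /occupation !big_ord0 addr0 lyap_ge0.
have [->|/eqP ne] := eqVneq x (0, 0); first by rewrite lyap_origin add0r.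
rewrite occupationS.
have := le_step alpha3 x IH; rewrite stepD step_cst //.
have := lyap_drift x; rewrite /origin (introF eqP ne) mulr0 addr0.
have := occupation_mono alpha3 (0, 0) g0 (leqnSn n).
have := axis_le_rare x; have /andP[_] := gb x.
by lra.
Qed.

(** * Moments *)

Lemma sqnorm_sym (i j : nat) :
  i%:R ^+ 2 + j%:R ^+ 2 = j%:R ^+ 2 + i%:R ^+ 2 :> R.
Proof. exact: addrC. Qed.

Lemma sqnorm_drift x : P sqnorm x - sqnorm x <= 1.
Proof.
have [->|i x0 E ne|a b E1 E2 x0 ne] := positionP x.
- rewrite /sqnorm (step_origin alpha sqnorm_sym) /absfun /=.
  by rewrite !(expr0n, expr1n) /=; lra.
- rewrite /sqnorm (step_axis alpha sqnorm_sym x0 E) (absfun_axis sqnorm_sym x0 E).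
  have l0 := leave_gt0 alpha i; have l4 := leave_le4 alpha3 i.
  have i0 : 0 <= i%:R :> R by [].
  move: (leave _ _) l0 l4 => l l0 l4.
  rewrite -![i.+2]addn2 -![i.+1]addn1 !natrD; move: (i%:R : R) i0 => t t0.
  have : 0 <= (1 / 4 - l) * t by rewrite mulr_ge0 ?subr_ge0.
  by lra.
- rewrite /sqnorm (step_bulk alpha sqnorm_sym E1 E2) /absfun E1 E2.
  rewrite -![a.+2]addn2 -![b.+2]addn2 -![a.+1]addn1 -![b.+1]addn1 !natrD.
  by rewrite le_eqVlt; apply/orP; left; apply/eqP; field.
Qed.

Lemma expect_sqnorm n x : expect n sqnorm x <= sqnorm x + n%:R.
Proof.
rewrite expect_drift lerD2l.
apply: le_trans (le_occupation alpha3 n x sqnorm_drift) _.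
rewrite /occupation (eq_bigr (fun=> 1)) => [|k _].
  by rewrite sumr_const card_ord.
exact: expect_cst.
Qed.

Lemma sqnorm2_drift x :
  P (fun y => sqnorm y ^+ 2) x - sqnorm x ^+ 2 <= 10 * sqnorm x + 2.
Proof.
have hs (i j : nat) : (i%:R ^+ 2 + j%:R ^+ 2) ^+ 2 =
  (j%:R ^+ 2 + i%:R ^+ 2) ^+ 2 :> R by rewrite addrC.
have -> : (fun y => sqnorm y ^+ 2) =
    absfun (fun i j => (i%:R ^+ 2 + j%:R ^+ 2) ^+ 2) by [].
have [->|i x0 E ne|a b E1 E2 x0 ne] := positionP x.
- rewrite /sqnorm (step_origin alpha hs) /absfun /=.
  by rewrite !(expr0n, expr1n) /=; lra.
- rewrite /sqnorm (step_axis alpha hs x0 E) (absfun_axis sqnorm_sym x0 E).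
  have l0 := leave_gt0 alpha i; have l4 := leave_le4 alpha3 i.
  have i0 : 0 <= i%:R :> R by [].
  move: (leave _ _) l0 l4 => l l0 l4.
  rewrite -![i.+2]addn2 -![i.+1]addn1 !natrD; move: (i%:R : R) i0 => t t0.
  have t2 : 0 <= t ^+ 2 := sqr_ge0 t.
  have t3 : 0 <= t ^+ 3 by rewrite exprn_ge0.
  have : 0 <= (1 / 4 - l) * (16 * t ^+ 3 + 40 * t ^+ 2 + 48 * t + 24).
    by rewrite mulr_ge0 ?subr_ge0 //; lra.
  by lra.
- rewrite /sqnorm (step_bulk alpha hs E1 E2) /absfun E1 E2.
  rewrite -![a.+2]addn2 -![b.+2]addn2 -![a.+1]addn1 -![b.+1]addn1 !natrD.
  have := sqr_ge0 (a%:R + 1%:R : R); have := sqr_ge0 (b%:R + 1%:R : R).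
  by lra.
Qed.

Lemma expect_sqnorm2 n x : sqnorm x <= 2 ->
  expect n (fun y => sqnorm y ^+ 2) x <= 22 * n.+1%:R ^+ 2.
Proof.
move=> x2; have := sqnorm_ge0 x => s0.
elim: n => [|n IH].
  by rewrite /expect /=; nra.
rewrite expectS -expect_step.
have := le_expect alpha3 n x sqnorm2_drift.
rewrite expectB expectD expectZ expect_cst //.
have := expect_sqnorm n x; move: IH.
rewrite -![n.+2]addn2 -![n.+1]addn1 !natrD; have : 0 <= n%:R :> R by [].
by move: (n%:R : R) => t; nra.
Qed.

(** [lyap] is of linear growth and the chain is diffusive. *)
Lemma expect_lyap n x : sqnorm x <= 2 ->
  expect n lyap x <= 15 * Num.sqrt n.+1%:R.
Proof.
move=> x2; set t := Num.sqrt _.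
have t1 : 1 <= t by rewrite -sqrtr1 ler_wsqrtr // ler1n.
have tt : t ^+ 2 = n.+1%:R by rewrite sqr_sqrtr.
have t0 : 0 < t by lra.
have : expect n (fun y => 2 * sqnorm y + t ^+ 2) x <= 5 * t ^+ 2.
  rewrite expectD expectZ expect_cst // tt -addn1 natrD.
  by have := expect_sqnorm n x; have : 0 <= n%:R :> R by []; lra.
move=> H.
pose b y := t^-1 * (2 * sqnorm y + t ^+ 2).
have lb y : lyap y <= b y + 9.
  apply: le_trans (lyap_le y) _; rewrite lerD2r /b mulrC ler_pdivlMl //.
  have := norm1_sq y; have := sqr_ge0 (norm1 y - t); lra.
apply: le_trans (le_expect alpha3 n x lb) _.
rewrite (expectD alpha n b (fun=> 9)) expectZ expect_cst.
have : t^-1 * expect n (fun y => 2 * sqnorm y + t ^+ 2) x <= 5 * t.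
  by rewrite mulrC ler_pdivrMr //; nra.
by lra.
Qed.

End Lyapunov.

(** * Ratio of occupation times *)

Section Ratio.
Variables (R : realType) (alpha : R).
Hypothesis alpha3 : 3 < alpha.
Implicit Types (x y : int * int) (f g h : int * int -> R) (n : nat).

Local Notation P := (step alpha).
Local Notation expect := (expect alpha).
Local Notation occupation := (occupation alpha).
Local Notation visits := (visits alpha).
Local Notation lyap := (@lyap R).
Local Notation axis := (@axis R).
Local Notation origin := (@origin R).

(** The expected sum of [g] before the first visit to the origin, or before
    time [m]. *)
Definition excursion_cost m g : int * int -> R :=
  iter m (fun h y => (1 - origin y) * (g y + P h y)) (fun=> 0).

Lemma excursion_costS m g x :
  excursion_cost m.+1 g x = (1 - origin x) * (g x + P (excursion_cost m g) x).
Proof. by []. Qed.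

Lemma co_origin_ge0 x : 0 <= 1 - origin x.
Proof. by rewrite subr_ge0 /origin; case: eqP. Qed.

Lemma excursion_cost_mono g x : (forall y, 0 <= g y) ->
  {homo (fun m => excursion_cost m g x) : m n / (m <= n)%N >-> m <= n}.
Proof.
move=> g0; apply: homo_leq => // [|m]; first exact: le_trans.
elim: m x => [|m IH] x.
  by rewrite excursion_costS mulr_ge0 ?co_origin_ge0 ?addr_ge0 ?step_ge0.
rewrite !excursion_costS ler_wpM2l ?co_origin_ge0 // lerD2l.
exact: le_step.
Qed.

Lemma excursion_cost_le m g x : (forall y, 0 <= g y <= axis y) ->
  excursion_cost m g x <= lyap x.
Proof.
move=> gb; elim: m x => [|m IH] x; first exact: lyap_ge0.
rewrite excursion_costS.
have := lyap_drift alpha3 x; have := lyap_ge0 R x.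
rewrite /origin; case: eqP => _ /=; first by rewrite subrr mul0r.
have := le_step alpha3 x IH; have /andP[_] := gb x.
have := axis_le_rare R x.
by lra.
Qed.

(** [K] is the expected sum of [g] over one excursion from the origin: the cost
    [f] until the next visit to the origin satisfies
    [P f - f = K * origin - g], and it is bounded by [lyap]. *)
Lemma ratio_law g : (forall y, 0 <= g y <= axis y) ->
  exists2 K, g (0, 0) + P (fun y => (1 - origin y) * g y) (0, 0) <= K &
    forall n x,
      `|occupation n g x - K * visits n x| <= lyap x + expect n lyap x.
Proof.
move=> gb; have g0 y : 0 <= g y by have /andP[] := gb y.
pose f y := limn (fun m => excursion_cost m g y).
have fcvg y : excursion_cost m g y @[m --> \oo] --> f y.
  apply: (nondecreasing_is_cvgn (excursion_cost_mono y g0)).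
  by exists (lyap y) => _ [m _ <-]; exact: excursion_cost_le.
have f_ge m y : excursion_cost m g y <= f y.
  apply: (nondecreasing_cvgn_le (excursion_cost_mono y g0)).
  by apply/cvg_ex; exists (f y).
have f0 y : 0 <= f y := f_ge 0%N y.
have fl y : f y <= lyap y.
  apply: limr_le; first by apply/cvg_ex; exists (f y).
  by near=> m; exact: excursion_cost_le.
have ff y : f y = (1 - origin y) * (g y + P f y).
  have c1 : excursion_cost m.+1 g y @[m --> \oo] --> f y.
    by rewrite (cvg_shiftS (fun m => excursion_cost m g y)).
  apply: (cvg_unique _ c1); first exact: norm_hausdorff.
  apply: cvgMr; apply: cvgD; first exact: cvg_cst.
  apply: (@cvg_big _ _ _ _ _ _ _ _ _
    (fun z m => trans alpha y z * excursion_cost m g z)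
    (fun z => trans alpha y z * f z)) => [|z _]; first exact: add_continuous.
  by apply: cvgMr; exact: fcvg.
have fO : f (0, 0) = 0 by rewrite ff /origin eqxx subrr mul0r.
exists (g (0, 0) + P f (0, 0)).
  rewrite lerD2l; apply: (le_step alpha3) => y.
  apply: le_trans (f_ge 1%N y); rewrite excursion_costS.
  by rewrite ler_wpM2l ?co_origin_ge0 // lerDl step_ge0.
move=> n x.
have drift : (fun y => P f y - f y) =
    (fun y => (g (0, 0) + P f (0, 0)) * origin y + - 1 * g y).
  apply/funext => y; rewrite [X in _ - X]ff /origin.
  by case: eqP => [->|_] /=; ring.
have := expect_drift alpha n f x; rewrite drift.
rewrite occupationD !occupationZ -/(visits n x) => e.
have := expect_ge0 alpha3 n x f0; have := le_expect alpha3 n x fl.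
have := f0 x; have := fl x.
have := lyap_ge0 R x; have := expect_ge0 alpha3 n x (@lyap_ge0 R).
by rewrite ler_norml; lra.
Unshelve. all: by end_near.
Qed.

End Ratio.

(** * The two potentials along the chain *)

Section Growth.
Variables (R : realType) (alpha : R).
Hypothesis alpha3 : 3 < alpha.
Implicit Types (x y : int * int) (f g h : int * int -> R) (n : nat).

Local Notation P := (step alpha).
Local Notation expect := (expect alpha).
Local Notation occupation := (occupation alpha).
Local Notation visits := (visits alpha).
Local Notation lyap := (@lyap R).
Local Notation axis := (@axis R).
Local Notation origin := (@origin R).
Local Notation rare := (@rare R).
Local Notation sqnorm := (@sqnorm R).
Local Notation norm1 := (@norm1 R).

Definition area : int * int -> R := absfun (fun i j => i%:R * j%:R).

Lemma area_sym (i j : nat) : i%:R * j%:R = j%:R * i%:R :> R.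
Proof. exact: mulrC. Qed.

Lemma area_ge0 x : 0 <= area x.
Proof. by rewrite mulr_ge0. Qed.

Lemma area_le x : 2 * area x <= sqnorm x.
Proof.
rewrite /area /sqnorm /absfun.
by have := sqr_ge0 (`|x.1|%N%:R - `|x.2|%N%:R : R); nra.
Qed.

Lemma area_drift_bounds x : 0 <= P area x - area x <= axis x.
Proof.
have [->|i x0 E ne|a b E1 E2 x0 ne] := positionP x.
- rewrite /area (step_origin alpha area_sym) /absfun /axis /=.
  by rewrite !(mulr0, mul0r, subr0) lexx ler01.
- rewrite /area (step_axis alpha area_sym x0 E) (absfun_axis area_sym x0 E).
  rewrite /axis x0 eqxx !(mulr0, mul0r, add0r, subr0, addr0) mulr1.
  have := leave_cube alpha3 i; have l0 := leave_gt0 alpha i.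
  have : i.+1%:R <= i.+1%:R ^+ 3 :> R by rewrite ler_eXnr ?ler1n.
  have : 0 <= i.+1%:R :> R by [].
  move: (leave _ _) l0 => l l0; move: (i.+1%:R : R) (_ ^+ 3) => t c t0 tc lc.
  have : l * t <= l * c by rewrite ler_wpM2l // ltW.
  have : 0 <= l * t by rewrite mulr_ge0 // ltW.
  by rewrite /=; lra.
- rewrite /area (step_bulk alpha area_sym E1 E2) /absfun E1 E2.
  rewrite /axis (introF eqP x0) /=.
  rewrite -![a.+2]addn2 -![b.+2]addn2 -![a.+1]addn1 -![b.+1]addn1 !natrD.
  by apply/andP; split; rewrite le_eqVlt; apply/orP; left; apply/eqP; field.
Qed.

Lemma area_drift_at1 : P area (1, 0) - area (1, 0) = 1 / 2.
Proof.
rewrite /area (@step_axis _ alpha _ _ 0 area_sym) // leave1 /absfun /=.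
by field.
Qed.

Definition clock : int * int -> R :=
  absfun (fun i j => timepot i%:R j%:R).

Lemma clock_sym (i j : nat) : timepot (i%:R : R) j%:R = timepot j%:R i%:R.
Proof. exact: timepotC. Qed.

Lemma clock_log x :
  0 <= clock x - 4 / pi * (area x * ln (sqnorm x)) <= 6 * area x.
Proof. exact: timepot_log. Qed.

Lemma lnD1_le (u : R) : 0 <= u -> ln (u + 1) <= u.
Proof. by move=> u0; rewrite addrC le_ln1Dx //; lra. Qed.

Lemma clock_drift_axis x : x.1 * x.2 = 0 -> `|P clock x - clock x - 1| <= 4.
Proof.
have [->|i x0 E ne|a b E1 E2 x0 ne] := positionP x => //.
  rewrite /clock (step_origin alpha clock_sym) /absfun /= !timepot0 //.
  by rewrite ler_norml; lra.
move=> _.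
rewrite /clock (step_axis alpha clock_sym x0 E) (absfun_axis clock_sym x0 E).
rewrite !timepot0 // mulr0 !add0r subr0.
have := timepot_log (ler0n R i.+1) ler01; rewrite expr1n mulr1.
have l0 := leave_gt0 alpha i; have := leave_cube alpha3 i.
move: (leave _ _) l0 => l l0; have : 1 <= i.+1%:R :> R by rewrite ler1n.
move: (i.+1%:R : R) => t t1 lc.
have u0 : 0 <= ln (t ^+ 2 + 1) by rewrite ln_ge0 // lerDr sqr_ge0.
have u1 := lnD1_le (sqr_ge0 t).
move: (timepot t 1) => c /andP[c0 c1].
have /andP[p0 p2] := pi_inv_bounds R.
have t0 : 0 <= t by lra.
have b0 : 0 <= t * ln (t ^+ 2 + 1) by rewrite mulr_ge0.
have b1 : t * ln (t ^+ 2 + 1) <= t ^+ 3.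
  by rewrite exprS ler_wpM2l.
have b2 : 0 <= 4 / pi * (t * ln (t ^+ 2 + 1)).
  by rewrite mulr_ge0 // mulr_ge0 // ltW.
have b3 : 4 / pi * (t * ln (t ^+ 2 + 1)) <= 2 * t ^+ 3.
  by apply: ler_pM => //; [rewrite mulr_ge0 // ltW | lra].
have t3 : t <= t ^+ 3 by rewrite ler_eXnr.
move: (4 / pi * _) b2 b3 c0 c1 => w b2 b3 c0 c1.
have c2 : l * c <= l * (8 * t ^+ 3) by rewrite ler_wpM2l ?(ltW l0) //; lra.
have c3 : 0 <= l * c by rewrite mulr_ge0 ?(ltW l0) //; lra.
by rewrite ler_norml; lra.
Qed.

Lemma clock_drift_bulk x : x.1 * x.2 <> 0 ->
  `|P clock x - clock x - 1| <= 8 / norm1 x.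
Proof.
have [->|i x0 E ne|a b E1 E2 x0 ne] := positionP x => // _.
rewrite /clock (step_bulk alpha clock_sym E1 E2) /norm1 /absfun E1 E2 natrD.
have := @timepot_laplacian R a.+1%:R b.+1%:R.
rewrite !ler1n => /(_ isT isT).
rewrite -![a.+2]addn2 -![b.+2]addn2 -![a.+1]addn1 -![b.+1]addn1 !natrD.
by rewrite -!addrA !subrr !addr0 !addrA -!natrD.
Qed.

(** Far from the corner the error [8 / norm1 x] is at most [delta]; near the
    corner and on the axes it is dominated by [rare], whose occupation is
    controlled by [rare_occupation]. *)
Lemma clock_drift (delta : R) : 0 < delta -> exists2 C, 0 <= C &
  forall x, `|P clock x - clock x - 1| <= delta + C * rare x.
Proof.
move=> d0; pose c := 8 / delta; have c0 : 0 < c by rewrite divr_gt0.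
exists (4 + 8 * ((c + 1) * (c + 2))).
  by rewrite addr_ge0 // mulr_ge0 // mulr_ge0; lra.
move=> x; have [x0|x0] := eqVneq (x.1 * x.2) 0.
  apply: le_trans (clock_drift_axis x0) _; rewrite /rare x0 eqxx mulr1.
  have : 0 <= (c + 1) * (c + 2) by rewrite mulr_ge0; lra.
  by lra.
apply: le_trans (clock_drift_bulk (elimN eqP x0)) _.
have r0 := rare_ge0 R x.
have s0 : 0 < norm1 x.
  by rewrite /norm1 /absfun ltr0n; move: x0; rewrite mulf_eq0; lia.
have [small|big] := leP (norm1 x) c; last first.
  have : 8 / norm1 x <= delta.
    by rewrite ler_pdivrMr // mulrC -ler_pdivrMr // ltW.
  have : 0 <= (4 + 8 * ((c + 1) * (c + 2))) * rare x.
    rewrite mulr_ge0 // addr_ge0 // mulr_ge0 // mulr_ge0; lra.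
  by lra.
have -> : 8 / norm1 x = 8 * ((norm1 x + 1) * (norm1 x + 2)) * rare x.
  rewrite /rare (negbTE x0); field; rewrite !gt_eqF //; lra.
have : (norm1 x + 1) * (norm1 x + 2) <= (c + 1) * (c + 2).
  by apply: ler_pM; lra.
move: ((_ + _) * _) ((c + 1) * _) => u v uv.
have : u * rare x <= v * rare x by rewrite ler_wpM2r.
by lra.
Qed.

(** The elementary inequality [ln z <= z / M + ln M], applied with [z] the
    ratio of [sqnorm x] and [N] or its inverse. *)
Lemma area_log_bound (N M : R) x : 0 < N -> 1 <= M ->
  `|area x * ln (sqnorm x) - ln N * area x| <=
    M^-1 * N + M^-1 / N * sqnorm x ^+ 2 + ln M * area x.
Proof.
move=> N0 M1; have M0 : 0 < M by lra.
have a0 := area_ge0 x; have a1 := area_le x.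
have lM : 0 <= ln M by rewrite ln_ge0.
have Mi : 0 < M^-1 by rewrite invr_gt0.
have Ni : 0 < N^-1 by rewrite invr_gt0.
have e1 : 0 <= M^-1 / N * sqnorm x ^+ 2.
  exact: mulr_ge0 (mulr_ge0 (ltW Mi) (ltW Ni)) (sqr_ge0 _).
have e2 : 0 <= M^-1 * N := mulr_ge0 (ltW Mi) (ltW N0).
have [q0|q0] := leP (sqnorm x) 0.
  have -> : area x = 0 by lra.
  by rewrite !(mul0r, mulr0) subrr normr0 addr0 addr_ge0.
have key (u v : R) : 0 < u -> 0 < v -> ln u - ln v <= M^-1 * (u / v) + ln M.
  move=> u0 v0.
  have w0 : 0 < M^-1 * (u / v) by rewrite mulr_gt0 // divr_gt0.
  have := ln_sublinear w0; rewrite lnM ?posrE ?divr_gt0 // lnV ?posrE //.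
  rewrite ln_div ?posrE //; lra.
have k1 := key _ _ q0 N0; have k2 := key _ _ N0 q0.
move: (sqnorm x) q0 a1 k1 k2 e1 => q q0 a1 k1 k2 e1.
move: (area x) a0 a1 => a a0 a1.
have c1 : a * (ln q - ln N) <= a * (M^-1 * (q / N) + ln M).
  by rewrite ler_wpM2l.
have c2 : a * (ln N - ln q) <= a * (M^-1 * (N / q) + ln M).
  by rewrite ler_wpM2l.
have d1 : a * (M^-1 * (q / N)) <= M^-1 / N * q ^+ 2.
  have -> : M^-1 / N * q ^+ 2 = q * (M^-1 * (q / N)) by ring.
  apply: ler_wpM2r; last by lra.
  by rewrite !mulr_ge0 ?ltW.
have d2 : a * (M^-1 * (N / q)) <= M^-1 * N.
  have -> : M^-1 * N = q * (M^-1 * (N / q)) by field; rewrite !gt_eqF.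
  apply: ler_wpM2r; last by lra.
  by rewrite !mulr_ge0 ?invr_ge0 ?ltW.
by rewrite ler_norml; lra.
Qed.

End Growth.

(** * Asymptotic comparison of powers and logarithms *)

Section Asymptotics.
Variable R : realType.

Lemma sqrt_ge1 n : 1 <= Num.sqrt n.+1%:R :> R.
Proof. by rewrite -[leLHS]sqrtr1 ler_wsqrtr ?ler1n. Qed.

Lemma near_le_ln (A : R) : \forall n \near \oo, A <= ln n%:R.
Proof.
near=> n; have h : expR A <= n%:R.
  by near: n; exact: nbhs_infty_ger.
rewrite -[A]expRK ler_ln ?posrE ?expR_gt0 //.
exact: lt_le_trans (expR_gt0 A) h.
Unshelve. all: by end_near. Qed.

Lemma near_sqrt_ln (A eps : R) : 0 <= A -> 0 < eps ->
  \forall n \near \oo,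
    A * (Num.sqrt n.+1%:R * (ln n%:R + 1) ^+ 2) <= eps * n%:R.
Proof.
move=> A0 e0.
(* with [t = (n + 1)^(1/8)], [ln n <= 8 * t] bounds the left-hand side by
   [81 * A * t^6], while [n >= t^8 / 2] *)
pose B := 162 * A / eps.
have B0 : 0 <= B by rewrite divr_ge0 ?mulr_ge0 // ltW.
near=> n.
have n1 : 1 <= n%:R :> R by near: n; exact: nbhs_infty_ger.
have nB : B ^+ 8 <= n%:R by near: n; exact: nbhs_infty_ger.
pose t : R := Num.sqrt (Num.sqrt (Num.sqrt n.+1%:R)).
have t8 : t ^+ 8 = n.+1%:R.
  by rewrite -[8%N]/(2 * (2 * 2))%N !exprM !sqr_sqrtr ?sqrtr_ge0.
have t4 : Num.sqrt n.+1%:R = t ^+ 4.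
  by rewrite -[4%N]/(2 * 2)%N exprM !sqr_sqrtr ?sqrtr_ge0.
have t0 : 0 <= t := sqrtr_ge0 _.
have tB : B <= t.
  have := le_trans nB (_ : n%:R <= t ^+ 8).
  by rewrite ler_pXn2r ?nnegrE // t8 ler_nat; apply.
have t1 : 1 <= t.
  have : 1 ^+ 8 <= t ^+ 8 by rewrite expr1n t8 ler1n.
  by rewrite ler_pXn2r ?nnegrE.
have l0 : 0 <= ln n%:R :> R by rewrite ln_ge0.
have l8 : ln n%:R <= 8 * t.
  have : ln n%:R <= ln (t ^+ 8).
    by rewrite ler_ln ?posrE ?t8 ?ltr0n ?ler_nat // -(ltr0n R) (lt_le_trans ltr01).
  have tp : 0 < t by lra.
  have := ln_sublinear tp.
  by rewrite lnXn // -mulr_natl; lra.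
have q : (ln n%:R + 1) ^+ 2 <= 81 * t ^+ 2.
  have -> : 81 * t ^+ 2 = (9 * t) ^+ 2 by ring.
  by rewrite ler_pXn2r ?nnegrE //; lra.
have hB : 162 * A <= eps * t ^+ 2.
  have : 162 * A = eps * B by rewrite /B; field; rewrite gt_eqF.
  have tt : t <= t ^+ 2 by rewrite ler_eXnr.
  move=> ->; rewrite ler_wpM2l ?(ltW e0) //; lra.
have n2 : t ^+ 8 <= 2 * n%:R by rewrite t8 -addn1 natrD; lra.
rewrite t4.
have s1 : A * (t ^+ 4 * (ln n%:R + 1) ^+ 2) <= A * (t ^+ 4 * (81 * t ^+ 2)).
  by rewrite ler_wpM2l // ler_wpM2l // exprn_ge0.
have s2 : 162 * A * t ^+ 6 <= eps * t ^+ 2 * t ^+ 6.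
  by rewrite ler_wpM2r // exprn_ge0.
have s3 : eps * t ^+ 8 <= eps * (2 * n%:R) by rewrite ler_wpM2l ?(ltW e0).
have e1 : A * (t ^+ 4 * (81 * t ^+ 2)) = 162 * A * t ^+ 6 / 2 by field.
have e2 : eps * t ^+ 2 * t ^+ 6 = eps * t ^+ 8 by ring.
lra.
Unshelve. all: by end_near. Qed.

End Asymptotics.

(** * The growth of the expected local times *)

Section GrowthLaw.
Variables (R : realType) (alpha : R).
Hypothesis alpha3 : 3 < alpha.
Implicit Types (x y : int * int) (f g h : int * int -> R) (n : nat).

Local Notation P := (step alpha).
Local Notation expect := (expect alpha).
Local Notation occupation := (occupation alpha).
Local Notation visits := (visits alpha).
Local Notation lyap := (@lyap R).
Local Notation axis := (@axis R).
Local Notation origin := (@origin R).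
Local Notation rare := (@rare R).
Local Notation sqnorm := (@sqnorm R).
Local Notation norm1 := (@norm1 R).
Local Notation area := (@area R).
Local Notation clock := (@clock R).

Lemma visits_ge0 n x : 0 <= visits n x.
Proof. by apply: occupation_ge0 => // y; exact: ler0n. Qed.

Lemma lyap_near x : sqnorm x <= 2 -> lyap x <= 13.
Proof.
move=> x2; apply: le_trans (lyap_le _ x) _.
have := norm1_sq R x; have := norm1_ge0 R x.
by move: (norm1 x) => s; nra.
Qed.

(** Started near the origin, the error in [ratio_law] is of the order of the
    distance covered in [n] steps. *)
Lemma ratio_error n m x : sqnorm x <= 2 -> (m <= n)%N ->
  lyap x + expect m lyap x <= 28 * Num.sqrt n.+1%:R.
Proof.
move=> x2 mn.
have := expect_lyap alpha3 m x2; have := lyap_near x2.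
have : Num.sqrt m.+1%:R <= Num.sqrt n.+1%:R :> R.
  by rewrite ler_wsqrtr // ler_nat.
have : 1 <= Num.sqrt m.+1%:R :> R := sqrt_ge1 _ _.
by lra.
Qed.

(** [area] grows on the axes only, so [ratio_law] applies to its drift; the
    constant is positive because of the drift [1 / 2] at the neighbours of the
    origin. *)
Lemma expect_area_visits : exists2 K, 0 < K & forall n m x,
  sqnorm x <= 2 -> (m <= n)%N ->
  `|expect m area x - K * visits m x| <= 29 * Num.sqrt n.+1%:R.
Proof.
have [K K0 HK] := ratio_law alpha3 (area_drift_bounds alpha3).
exists K.
  apply: lt_le_trans K0.
  have d0 y : 0 <= (1 - origin y) * (P area y - area y).
    by rewrite mulr_ge0 ?co_origin_ge0 //; have /andP[] := area_drift_bounds alpha3 y.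
  have /andP[a0 _] := area_drift_bounds alpha3 (0, 0).
  rewrite ltr_wpDl // /step big_cons.
  apply: ltr_pwDl; last first.
    by apply: sumr_ge0 => y _; rewrite mulr_ge0 ?trans_ge0.
  rewrite -[(_ + 1, _)]/((1, 0) : int * int) area_drift_at1.
  by rewrite /trans /origin /=; lra.
move=> n m x x2 mn; have := HK m x; have := ratio_error x2 mn.
rewrite (expect_drift _ _ area).
have : area x <= 1 by have := area_le R x; lra.
have := area_ge0 R x.
have : 1 <= Num.sqrt n.+1%:R :> R := sqrt_ge1 _ _.
rewrite !ler_norml; lra.
Qed.

(** Comparing the two potentials: [clock] grows by the elapsed time, and it is
    [4 / pi * ln n * area] up to errors negligible on the scale [n]. *)
Lemma clock_area_balance (eta : R) : 0 < eta -> exists2 C, 0 <= C &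
  forall n m x, (0 < n)%N -> (m <= n)%N -> sqnorm x <= 2 ->
  `|4 / pi * ln n%:R * expect m area x - m%:R| <=
    eta * n%:R + C * (1 + visits m x) + C * expect m area x.
Proof.
move=> e0; have e4 : 0 < eta / 4 by lra.
have [C0 C00 HC0] := clock_drift alpha3 e4.
(* [89 = 1 + 22 * 2^2] collects the two error terms of [area_log_bound], the
   second one through [expect_sqnorm2] and [m + 1 <= 2 * n] *)
pose M : R := 8 * 89 / eta + 1.
have eM : eta * M = 8 * 89 + eta by rewrite /M; field; rewrite gt_eqF.
have M1 : 1 <= M by rewrite lerDr !mulr_ge0 ?invr_ge0 // ltW.
have M0 : 0 < M by lra.
have lM : 0 <= ln M by rewrite ln_ge0.
exists (8 + 13 * C0 + 6 + 2 * ln M); first by lra.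
move=> n m x n0 mn x2.
have v0 := visits_ge0 m x; set v := visits m x in v0 *.
have Ea0 := expect_ge0 alpha3 m x (@area_ge0 R).
set Ea := expect m area x in Ea0 *.
have N1 : 1 <= n%:R :> R by rewrite ler1n.
have N0 : 0 < n%:R :> R by lra.
have mN : m%:R <= n%:R :> R by rewrite ler_nat.
have cb : 0 <= 4 / (pi : R) <= 2.
  have /andP[p0 p2] := pi_inv_bounds R.
  by rewrite mulr_ge0 ?(ltW p0) //=; lra.
have logs := clock_log R.
move: (4 / pi) cb logs => c /andP[c0 c2] logs.
(* [sqnorm x <= 2] forces [area x <= 1], with [area x = 0] unless
   [sqnorm x > 1] *)
have clockx : `|clock x| <= 8.
  have /andP[k0 k1] := logs x.
  have a0 := area_ge0 R x; have a2 := area_le R x.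
  have s0 := sqnorm_ge0 R x.
  have [l0|l0] := leP (sqnorm x) 0.
    have a00 : area x = 0 by lra.
    by move: k0 k1; rewrite a00 !(mul0r, mulr0) subr0 ler_norml; lra.
  have [l1|l1] := leP (sqnorm x) 1.
    have a00 : area x = 0.
      have : area x < 1 by lra.
      by rewrite /area /absfun -natrM ltrn1 ltnS leqn0 => /eqP ->.
    by move: k0 k1; rewrite a00 !(mul0r, mulr0) subr0 ler_norml; lra.
  have u0 : 0 <= ln (sqnorm x) by rewrite ln_ge0 // ltW.
  have u1 : ln (sqnorm x) <= 1.
    have := @le_ln1Dx R (sqnorm x - 1); rewrite addrCA subrr addr0 => H.
    by apply: le_trans (H _) _; lra.
  have w0 : 0 <= area x * ln (sqnorm x) by rewrite mulr_ge0.
  have w1 : area x * ln (sqnorm x) <= 1.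
    by rewrite -[1]mulr1; apply: ler_pM => //; lra.
  have z0 : 0 <= c * (area x * ln (sqnorm x)).
    by rewrite mulr_ge0.
  have z1 : c * (area x * ln (sqnorm x)) <= 2 * 1.
    exact: ler_pM.
  by move: (c * _) z0 z1 k0 k1 => z z0 z1 k0 k1; rewrite ler_norml; lra.
have step1 : `|expect m clock x - m%:R| <= 8 + eta / 4 * m%:R + C0 * (13 + 12 * v).
  rewrite expect_drift.
  have occm (a : R) : occupation m (fun=> a) x = a * m%:R.
    rewrite /occupation (eq_bigr (fun=> a)) => [|k _]; last exact: expect_cst.
    by rewrite sumr_const card_ord mulr_natr.
  have up := le_occupation alpha3 m x
    (f := fun y => P clock y - clock y) (g := fun y => (1 + eta / 4) + C0 * rare y).
  have lo := le_occupation alpha3 m x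
    (g := fun y => P clock y - clock y) (f := fun y => (1 - eta / 4) + (- C0) * rare y).
  rewrite !(occupationD _ _ (fun=> _) (fun y => _ * rare y)) !occupationZ !occm in up lo.
  have hu y : P clock y - clock y <= (1 + eta / 4) + C0 * rare y.
    by have := HC0 y; rewrite ler_norml; lra.
  have hl y : (1 - eta / 4) + (- C0) * rare y <= P clock y - clock y.
    by have := HC0 y; rewrite ler_norml; lra.
  have := up hu; have := lo hl.
  have r1 : C0 * occupation m rare x <= C0 * (13 + 12 * v).
    rewrite ler_wpM2l //; apply: le_trans (rare_occupation alpha3 m x) _.
    by rewrite lerD2r; exact: lyap_near.
  move: clockx; rewrite !ler_norml; lra.
have step2 : `|expect m clock x - c * expect m (fun y => area y * ln (sqnorm y)) x|
    <= 6 * Ea.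
  rewrite -expectZ -expectB -expectZ; apply: le_trans (ler_norm_expect alpha3 _ _ _) _.
  apply: le_expect => // y; have /andP[k0 k1] := logs y.
  by rewrite ger0_norm.
have step3 : `|expect m (fun y => area y * ln (sqnorm y)) x - ln n%:R * Ea|
    <= 89 * (M^-1 * n%:R) + ln M * Ea.
  rewrite -expectZ -expectB; apply: le_trans (ler_norm_expect alpha3 _ _ _) _.
  apply: le_trans (le_expect alpha3 m x (fun y => area_log_bound y N0 M1)) _.
  rewrite (expectD _ _ (fun y => _ + _ * sqnorm y ^+ 2)).
  rewrite (expectD _ _ (fun=> _)) !expectZ expect_cst // lerD2r.
  have := expect_sqnorm2 alpha3 m x2; set q := expect _ _ _ => qm.
  have m2 : m.+1%:R ^+ 2 <= (2 * n%:R) ^+ 2 :> R.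
    by rewrite ler_pXn2r ?nnegrE // -addn1 natrD; lra.
  have h : M^-1 / n%:R * q <= M^-1 / n%:R * (88 * n%:R ^+ 2).
    by apply: ler_wpM2l; [rewrite divr_ge0 ?invr_ge0 ?ltW | lra].
  have e : M^-1 / n%:R * (88 * n%:R ^+ 2) = 88 * (M^-1 * n%:R).
    by field; rewrite !gt_eqF.
  lra.
have Mn : 89 * (M^-1 * n%:R) <= eta / 8 * n%:R.
  rewrite mulrA; apply: ler_wpM2r; first exact: ltW.
  by rewrite ler_pdivrMr //; lra.
have step4 : `|c * expect m (fun y => area y * ln (sqnorm y)) x
     - c * ln n%:R * Ea| <= 2 * (89 * (M^-1 * n%:R) + ln M * Ea).
  rewrite -(mulrA c) -mulrBr normrM ler_pM //.
  by rewrite ger0_norm.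
have Cv : 0 <= C0 * v by rewrite mulr_ge0.
have lE : 0 <= ln M * Ea by rewrite mulr_ge0.
have lv : 0 <= ln M * v by rewrite mulr_ge0.
have CE : 0 <= C0 * Ea by rewrite mulr_ge0.
have em : eta / 4 * m%:R <= eta / 4 * n%:R by rewrite ler_wpM2l // ltW.
have en : 0 <= eta * n%:R by rewrite mulr_ge0 // ltW.
move: step1 step2 step4; move: (c * ln _ * Ea) (c * _) (expect m clock x).
by move=> a b d; rewrite !ler_norml; lra.
Qed.

(** Eliminating [area] between [clock_area_balance] and [expect_area_visits].
    The remaining errors contain the number of visits itself, but without the
    factor [ln n], so they are absorbed for large [n]. *)
Lemma visits_growth : exists2 gamma : R, 0 < gamma & forall eta : R, 0 < eta ->
  \forall n \near \oo, forall m x, (m <= n)%N -> sqnorm x <= 2 ->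
    `|gamma * (ln n%:R * visits m x) - m%:R| <= eta * n%:R.
Proof.
have [K K0 HK] := expect_area_visits.
have /andP[p0 p2] := pi_inv_bounds R.
have g0 : 0 < 4 / pi * K by rewrite !mulr_gt0.
exists (4 / pi * K) => // eta e0.
have e4 : 0 < eta / 4 by lra.
have [C C0 HC] := clock_area_balance e4.
pose D := C * (1 + K); have D0 : 0 <= D by rewrite mulr_ge0 ?addr_ge0 // ltW.
set gamma := 4 / pi * K in g0 *.
near=> n.
have N0 : (0 < n)%N by near: n; exists 1%N.
have N1 : 1 <= n%:R :> R by rewrite ler1n.
have L2 : 2 * D / gamma <= ln n%:R by near: n; exact: near_le_ln.
have L3 : D * (8 * (1 + eta)) / (gamma * eta) <= ln n%:R.
  by near: n; exact: near_le_ln.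
have L1 : 1 <= ln n%:R :> R by near: n; exact: near_le_ln.
have S : (C + 29 * C + 58) * (Num.sqrt n.+1%:R * (ln n%:R + 1) ^+ 2)
    <= eta / 4 * n%:R.
  by near: n; apply: near_sqrt_ln => //; lra.
move=> m x mn x2.
have mN : m%:R <= n%:R :> R by rewrite ler_nat.
have v0 := visits_ge0 m x.
have {HC} := HC n m x N0 mn x2; have {HK} := HK n m x x2 mn.
move: (expect m area x) => Ea.
move: (visits m x) v0 => v v0 HE HB.
move: (ln n%:R) L1 L2 L3 S HB => L L1 L2 L3 S HB.
have r1 : 1 <= Num.sqrt n.+1%:R :> R := sqrt_ge1 _ _.
move: (Num.sqrt _) r1 S HE => r r1 S HE.
have rL : r <= r * (L + 1) ^+ 2.
  by rewrite ler_peMr ?exprn_ege1 //; lra.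
have rLL : L * r <= r * (L + 1) ^+ 2.
  by rewrite mulrC ler_wpM2l //; [lra|nra].
have one : 1 <= r * (L + 1) ^+ 2 by lra.
move: (r * _) S rL rLL one => Q S rL rLL one.
(* the error of replacing [Ea] by [K * v] *)
have err : `|4 / pi * L * Ea - gamma * (L * v)| <= 58 * (L * r).
  have -> : 4 / pi * L * Ea - gamma * (L * v) = (4 / pi * L) * (Ea - K * v).
    by rewrite /gamma; ring.
  have -> : 58 * (L * r) = (2 * L) * (29 * r) by ring.
  rewrite normrM ler_pM // ger0_norm.
    by rewrite ler_wpM2r //; lra.
  by rewrite !mulr_ge0 ?(ltW p0) //; lra.
have CE : C * Ea <= C * (K * v + 29 * r).
  by rewrite ler_wpM2l //; move: HE; rewrite ler_norml; lra.
have Cr : C * r <= C * Q by rewrite ler_wpM2l.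
have Cone : C <= C * Q by rewrite ler_peMr.
(* all errors but [D * v] are negligible on the scale [n] *)
have star : `|gamma * (L * v) - m%:R| <= eta / 2 * n%:R + D * v.
  move: HB err; rewrite /D; move: (4 / pi * L * Ea) (gamma * (L * v)) => a b.
  by rewrite !ler_norml; lra.
have en : 0 <= eta * n%:R by rewrite mulr_ge0 //; lra.
have Dg : D <= gamma * L / 2.
  by move: L2; rewrite ler_pdivrMr //; lra.
have Dv : D * v <= gamma * L / 2 * v by rewrite ler_wpM2r.
(* first a crude bound on [v], which then shows that [D * v] is negligible *)
have vb : gamma * L * v <= 2 * (1 + eta) * n%:R.
  by move: star; rewrite ler_norml; lra.
have Dv2 : 8 * (1 + eta) * (D * v) <= 2 * eta * ((1 + eta) * n%:R).
  have : D * (8 * (1 + eta)) * v <= L * (gamma * eta) * v.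
    by rewrite ler_wpM2r //; move: L3; rewrite ler_pdivrMr // mulr_gt0.
  have : eta * (gamma * L * v) <= eta * (2 * (1 + eta) * n%:R).
    by rewrite ler_wpM2l // ltW.
  by lra.
have Dv3 : D * v <= eta / 4 * n%:R.
  have : 0 < 8 * (1 + eta) by lra.
  by move=> /ler_pM2l <-; lra.
by apply: le_trans star _; lra.
Unshelve. all: by end_near. Qed.

(** By [ratio_law] any functional of the visits to the axes is proportional to
    the number of visits to the origin, up to an error of order [sqrt n]. *)
Lemma occupation_growth g : (forall y, 0 <= g y <= axis y) -> 0 < g (0, 0) ->
  exists2 kappa : R, 0 < kappa & forall eta : R, 0 < eta ->
  \forall n \near \oo, forall m x, (m <= n)%N -> sqnorm x <= 2 ->
    `|ln n%:R * occupation m g x - kappa * m%:R| <= eta * n%:R.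
Proof.
move=> gb gO; have [gamma ga0 Hg] := visits_growth.
have [K K0 HK] := ratio_law alpha3 gb.
have Kp : 0 < K.
  apply: lt_le_trans K0; rewrite ltr_wpDr // step_ge0 // => y.
  by rewrite mulr_ge0 ?co_origin_ge0 //; have /andP[] := gb y.
exists (K / gamma); first by rewrite divr_gt0.
move=> eta e0; have e2 : 0 < eta / 2 * (gamma / K) by rewrite mulr_gt0 ?divr_gt0.
near=> n.
have HV : forall m x, (m <= n)%N -> sqnorm x <= 2 ->
    `|gamma * (ln n%:R * visits m x) - m%:R| <= eta / 2 * (gamma / K) * n%:R.
  by near: n; exact: Hg.
have L1 : 1 <= ln n%:R :> R by near: n; exact: near_le_ln.
have S : 28 * (Num.sqrt n.+1%:R * (ln n%:R + 1) ^+ 2) <= eta / 2 * n%:R.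
  by near: n; apply: near_sqrt_ln => //; lra.
move=> m x mn x2; have := HV m x mn x2.
have := le_trans (HK m x) (ratio_error x2 mn).
have r1 : 1 <= Num.sqrt n.+1%:R :> R := sqrt_ge1 _ _.
move: (Num.sqrt _) r1 S => r r1 S.
move: (occupation m g x) (visits m x) => o v Ho Hv.
have -> : ln n%:R * o - K / gamma * m%:R =
    ln n%:R * (o - K * v) + K / gamma * (gamma * (ln n%:R * v) - m%:R).
  by field; rewrite gt_eqF.
move: (ln n%:R) L1 S Hv => L L1 S Hv.
have rLL : L * r <= r * (L + 1) ^+ 2.
  by rewrite mulrC ler_wpM2l //; [lra|nra].
apply: le_trans (ler_normD _ _) _; rewrite normrM [X in _ + X]normrM.
rewrite (ger0_norm (_ : 0 <= L)); last by lra.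
rewrite (gtr0_norm (_ : 0 < K / gamma)) ?divr_gt0 //.
have a1 : L * `|o - K * v| <= L * (28 * r) by rewrite ler_wpM2l //; lra.
have a2 : K / gamma * `|gamma * (L * v) - m%:R| <=
    K / gamma * (eta / 2 * (gamma / K) * n%:R).
  by rewrite ler_wpM2l // divr_ge0 // ltW.
have e : K / gamma * (eta / 2 * (gamma / K) * n%:R) = eta / 2 * n%:R.
  by field; rewrite !gt_eqF.
by lra.
Unshelve. all: by end_near. Qed.

End GrowthLaw.

(** * Expectations over paths and the second moment *)

Section Paths.
Variables (R : realType) (alpha : R).
Hypothesis alpha3 : 3 < alpha.
Implicit Types (x y : int * int) (g h : int * int -> R) (n : nat).
Implicit Types (F G : seq (int * int) -> R) (l : seq (int * int)).

Local Notation P := (step alpha).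
Local Notation expect := (expect alpha).
Local Notation occupation := (occupation alpha).
Local Notation lyap := (@lyap R).
Local Notation axis := (@axis R).
Local Notation sqnorm := (@sqnorm R).
Local Notation norm1 := (@norm1 R).

Fixpoint path_expect n F x : R :=
  if n is n'.+1 then P (fun y => path_expect n' (fun l => F (y :: l)) y) x
  else F [::].

Definition path_sum g l : R := \sum_(y <- l) g y.

Lemma path_expectS n F x : path_expect n.+1 F x =
  P (fun y => path_expect n (fun l => F (y :: l)) y) x.
Proof. by []. Qed.

Lemma eq_path_expect n F G x : F =1 G -> path_expect n F x = path_expect n G x.
Proof. by move=> FG; have -> : F = G by apply/funext. Qed.

Lemma path_expectD n F G x : path_expect n (fun l => F l + G l) x =
  path_expect n F x + path_expect n G x.
Proof.
elim: n F G x => //= n IH F G x; rewrite -stepD.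
by apply: eq_step => y; rewrite IH.
Qed.

Lemma path_expectZ n c F x :
  path_expect n (fun l => c * F l) x = c * path_expect n F x.
Proof.
elim: n F x => //= n IH F x; rewrite -stepZ.
by apply: eq_step => y; rewrite IH.
Qed.

Lemma path_expect_cst n c x : path_expect n (fun=> c) x = c.
Proof.
elim: n x => //= n IH x; rewrite -[RHS](step_cst alpha c x).
by apply: eq_step => y; rewrite IH.
Qed.

Lemma le_path_expect n F G x : (forall l, F l <= G l) ->
  path_expect n F x <= path_expect n G x.
Proof.
elim: n F G x => [|n IH] F G x FG /=; first exact: FG.
by apply: le_step => // y; apply: IH => l; exact: FG.
Qed.

Lemma path_sum_mean n g x :
  path_expect n (path_sum g) x = occupation n.+1 g x - g x.
Proof.
elim: n x => [|n IH] x.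
  rewrite /occupation big_ord1 /= /path_sum big_nil.
  by rewrite /expect /= subrr.
rewrite occupationS addrAC subrr add0r /=; apply: eq_step => y.
rewrite (eq_path_expect _ _ (G := fun l => g y + path_sum g l)) => [|l].
  by rewrite path_expectD path_expect_cst IH addrC subrK.
by rewrite /path_sum big_cons.
Qed.

Lemma path_sum_square_step n g x :
  path_expect n.+1 (fun l => path_sum g l ^+ 2) x =
  P (fun y => g y ^+ 2 + 2 * g y * path_expect n (path_sum g) y
              + path_expect n (fun l => path_sum g l ^+ 2) y) x.
Proof.
rewrite path_expectS; apply: eq_step => y.
rewrite [LHS](eq_path_expect _ _ (G := fun l => (g y ^+ 2 + 2 * g y * path_sum g l)
   + path_sum g l ^+ 2)) => [|l].
  by rewrite !path_expectD path_expectZ path_expect_cst.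
by rewrite /path_sum big_cons; ring.
Qed.

(** A bound on the means that is affine in the number of steps, with [lyap]
    accounting for the starting point, gives a bound on the second moment. *)
Lemma path_sum_square_le n g x (a b : R) : 0 <= a ->
  (forall y, 0 <= g y <= axis y) ->
  (forall k y, (k <= n)%N ->
     path_expect k (path_sum g) y <= lyap y + b + a * k%:R) ->
  path_expect n (fun l => path_sum g l ^+ 2) x <=
  occupation n (P (fun y => g y * (1 + 2 * b + 2 * lyap y))) x
  + 2 * a * \sum_(k < n) path_expect k (path_sum g) x.
Proof.
move=> a0 gb; set h := fun y => g y * _.
have g0 y : 0 <= g y by have /andP[] := gb y.
elim: n x => [|n IH] x mb.
  by rewrite /occupation !big_ord0 /= /path_sum big_nil expr0n mulr0 addr0.
have {}IH y := IH y (fun k y kn => mb k y (leqW kn)).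
rewrite path_sum_square_step big_ord_recl /= [X in X + \sum_(_ < _) _]/path_sum big_nil.
rewrite add0r.
have -> : occupation n.+1 (P h) x = P (fun y => h y + occupation n (P h) y) x.
  rewrite stepD occupationS; congr (_ + _).
have -> : \sum_(i < n) P
      (fun y => path_expect i (fun l => path_sum g (y :: l)) y) x =
    P (fun y => n%:R * g y + \sum_(i < n) path_expect i (path_sum g) y) x.
  rewrite [RHS](@eq_step _ _ _
    (fun y => \sum_(i < n) (g y + path_expect i (path_sum g) y))) => [|y].
    rewrite (step_sum alpha n (fun i y => g y + path_expect i (path_sum g) y)); apply: eq_bigr => i _; apply: eq_step => y.
    rewrite (eq_path_expect _ _ (G := fun l => g y + path_sum g l)) => [|l].
      by rewrite path_expectD path_expect_cst.
    by rewrite /path_sum big_cons.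
  by rewrite big_split sumr_const card_ord mulr_natl.
rewrite -stepZ -stepD; apply: le_step => // y.
have := IH y; have := mb n y (leqnSn n).
have /andP[gy0 gy1] := gb y.
have gy2 : g y <= 1 by apply: le_trans gy1 _; rewrite /axis; case: eqP.
rewrite /h; set p := path_expect n (path_sum g) y; set q := path_expect n _ y.
move: p q (\sum_(_ < _) _) (occupation _ _ _) => p q s o Hp Hq.
have : 2 * g y * p <= 2 * g y * (lyap y + b + a * n%:R).
  by rewrite ler_wpM2l // mulr_ge0.
have : g y ^+ 2 <= g y by rewrite expr2 ler_piMr.
by lra.
Qed.

(** A visit to an axis within distance [r] costs at most a multiple of [r], and
    a visit beyond is paid for by [sqnorm]. *)
Lemma axis_lyap_le g y (r : R) : 0 < r -> 0 <= g y <= axis y ->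
  g y * lyap y <= (9 + 2 * r) * g y + 4 / r * sqnorm y.
Proof.
move=> r0 /andP[g0 g1].
have g2 : g y <= 1 by apply: le_trans g1 _; rewrite /axis; case: eqP.
have s0 := norm1_ge0 R y; have s2 := norm1_sq R y.
have l0 := lyap_le R y.
have : g y * lyap y <= g y * (2 * norm1 y + 9) by rewrite ler_wpM2l.
have gs : g y * norm1 y <= g y * r + norm1 y ^+ 2 / r.
  have q0 : 0 <= norm1 y ^+ 2 / r by rewrite divr_ge0 ?sqr_ge0 // ltW.
  have [sr|rs] := leP (norm1 y) r.
    have : g y * norm1 y <= g y * r by rewrite ler_wpM2l.
    by lra.
  have : g y * norm1 y <= norm1 y ^+ 2 / r.
    rewrite ler_pdivlMr // expr2 mulrAC; apply: ler_wpM2r => //.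
    by apply: le_trans (_ : 1 * r <= _); [rewrite ler_wpM2r // ltW | lra].
  have : 0 <= g y * r by rewrite mulr_ge0 // ltW.
  by lra.
have : norm1 y ^+ 2 / r <= 2 * sqnorm y / r by rewrite ler_wpM2r // invr_ge0 ltW.
by move: (lyap y) gs => lv; rewrite (_ : 4 / r * _ = 2 * (2 * sqnorm y / r)); [lra|ring].
Qed.

(** With [u = n / L], the mean is close to [kappa * u], and the second moment is
    at most about [(kappa * u)^2]: after a visit at time [k] the mean number of
    further visits is at most about [kappa * (n - k) / L], so summing by parts
    over [k] gives [2 * (kappa / L) * (kappa / L) * sum_k k], and
    [sum_k k] is about [n^2 / 2]. *)
Lemma path_sum_variance g n (kappa eta L : R) :
  (forall y, 0 <= g y <= axis y) -> 0 < kappa -> 0 < eta <= 1 -> (0 < n)%N ->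
  1 <= L -> Num.sqrt n.+1%:R * (L + 1) ^+ 2 <= eta / 78 * n%:R ->
  (forall m x, (m <= n)%N -> sqnorm x <= 2 ->
    `|L * occupation m g x - kappa * m%:R| <= eta * n%:R) ->
  path_expect n (fun l => (path_sum g l - kappa * (n%:R / L)) ^+ 2) (1, 1)
    <= eta * (12 * kappa + 9) * (n%:R / L) ^+ 2.
Proof.
move=> gb k0 /andP[e0 e1] n0 L1 S HG.
have g0 y : 0 <= g y by have /andP[] := gb y.
have g1 y : g y <= 1.
  by have /andP[_ /le_trans] := gb y; apply; rewrite /axis; case: eqP.
have N1 : 1 <= n%:R :> R by rewrite ler1n.
have r1 := sqrt_ge1 R n.
have rr : Num.sqrt n.+1%:R ^+ 2 = n.+1%:R :> R by rewrite sqr_sqrtr.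
move: (Num.sqrt _) r1 rr S => r r1 rr S.
have L0 : 0 < L by lra.
have : 0 < n%:R / L by rewrite divr_gt0 //; lra.
have : n%:R = L * (n%:R / L) by rewrite mulrC divfK // gt_eqF.
move: (n%:R / L) => u Lu u0.
have eu : 1 <= eta * u.
  have : L <= eta * n%:R.
    have Lq : L <= (L + 1) ^+ 2 by nra.
    have : (L + 1) ^+ 2 <= r * (L + 1) ^+ 2 by rewrite ler_peMl ?sqr_ge0.
    have : eta / 78 * n%:R <= eta * n%:R by rewrite ler_wpM2r //; lra.
    by lra.
  by rewrite Lu mulrCA ler_pMr.
(* the visits far out on the axes will cost [(46 + 16) * (n * r)] *)
have nr : n%:R * r <= eta / 78 * u ^+ 2.
  rewrite -(ler_pM2l (_ : 0 < L ^+ 2)) ?exprn_gt0 //.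
  have -> : L ^+ 2 * (eta / 78 * u ^+ 2) = eta / 78 * n%:R * n%:R.
    by rewrite Lu; ring.
  have -> : L ^+ 2 * (n%:R * r) = (r * L ^+ 2) * n%:R by ring.
  rewrite ler_wpM2r //; apply: le_trans S.
  by rewrite ler_wpM2l ?ler_pXn2r ?nnegrE //; lra.
have x02 : sqnorm (1, 1) <= 2.
  by rewrite /sqnorm /absfun /= expr1n.
have x00 : sqnorm (0, 0) <= 2.
  by rewrite /sqnorm /absfun /= expr0n /= addr0.
have occ_le m x : (m <= n)%N -> sqnorm x <= 2 ->
    occupation m g x <= kappa / L * m%:R + eta * u.
  move=> mn x2; have := HG m x mn x2; rewrite ler_norml => /andP[_ h].
  rewrite -(ler_pM2l L0) mulrDr mulrA (mulrC L (kappa / L)) divfK ?gt_eqF //.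
  by move: h; rewrite (mulrCA L) -Lu; lra.
have eg k x : 0 <= expect k g x <= 1.
  rewrite expect_ge0 //= -(expect_cst alpha k 1 x); exact: le_expect.
have meanE k x : path_expect k (path_sum g) x = occupation k g x + expect k g x - g x.
  by rewrite path_sum_mean /occupation big_ord_recr.
have a0 : 0 <= kappa / L by rewrite divr_ge0 // ltW.
have mean_le k x : path_expect k (path_sum g) x <= occupation k g x + 1.
  by rewrite meanE; have := g0 x; have /andP[_] := eg k x; lra.
have mean_ge : (kappa - 2 * eta) * u <= path_expect n (path_sum g) (1, 1).
  have := HG n (1, 1) (leqnn n) x02; rewrite ler_norml => /andP[h _].
  rewrite meanE; have := g1 (1, 1); have /andP[+ _] := eg n (1, 1).
  have : L * ((kappa - eta) * u) <= L * occupation n g (1, 1).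
    by rewrite (_ : L * _ = (kappa - eta) * n%:R); [lra | rewrite Lu; ring].
  by rewrite ler_pM2l //; lra.
have sq : path_expect n (fun l => path_sum g l ^+ 2) (1, 1) <=
    kappa ^+ 2 * u ^+ 2 + eta * (8 * kappa + 9) * u ^+ 2.
  apply: le_trans (path_sum_square_le (a := kappa / L) (b := eta * u + 1) _ a0 gb _) _.
    move=> k y kn; apply: le_trans (mean_le k y) _.
    have := occupation_from alpha3 k y gb; have := occ_le k (0, 0) kn x00.
    by lra.
  have sum1 : \sum_(k < n) path_expect k (path_sum g) (1, 1) <=
      kappa / L * (n%:R ^+ 2 / 2) + 2 * (eta * u) * n%:R.
    have s1 : \sum_(k < n) path_expect k (path_sum g) (1, 1) <=
        \sum_(k < n) (kappa / L * k%:R + 2 * (eta * u)).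
      apply: ler_sum => k _; apply: le_trans (mean_le k _) _.
      by have := occ_le k _ (ltnW (ltn_ord k)) x02; lra.
    apply: le_trans s1 _.
    rewrite big_split /= -mulr_sumr sumr_const card_ord -[X in _ + X]mulr_natr.
    rewrite lerD2r ler_wpM2l //.
    elim: (n) => [|m IH]; first by rewrite big_ord0 mulr_ge0.
    rewrite big_ord_recr /= -[m.+1]addn1 natrD; have : 0 <= m%:R :> R by [].
    by lra.
  have aL : 2 * (kappa / L) * (kappa / L * (n%:R ^+ 2 / 2) + 2 * (eta * u) * n%:R)
      = kappa ^+ 2 * u ^+ 2 + 4 * kappa * eta * u ^+ 2.
    by rewrite Lu; field; rewrite gt_eqF.
  have t2 : 2 * (kappa / L) * \sum_(k < n) path_expect k (path_sum g) (1, 1) <=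
      kappa ^+ 2 * u ^+ 2 + 4 * kappa * eta * u ^+ 2.
    by rewrite -aL ler_wpM2l // mulr_ge0.
  have r0 : 0 < r by lra.
  (* the threshold of [axis_lyap_le] is [r = sqrt (n + 1)] *)
  pose D := 1 + 2 * (eta * u + 1) + 2 * (9 + 2 * r).
  have D0 : 0 <= D.
    have : 0 <= eta * u by rewrite mulr_ge0 ?(ltW e0) ?(ltW u0).
    by rewrite /D; lra.
  have hb y : g y * (1 + 2 * (eta * u + 1) + 2 * lyap y) <=
      D * g y + 8 / r * sqnorm y.
    have := axis_lyap_le r0 (gb y).
    rewrite (_ : 8 / r * sqnorm y = 2 * (4 / r * sqnorm y)); last by ring.
    by rewrite /D; lra.
  have t1 : occupation n (P (fun y => g y * (1 + 2 * (eta * u + 1) + 2 * lyap y)))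
      (1, 1) <= D * (occupation n g (1, 1) + 1) + 8 / r * (2 * n%:R * r ^+ 2).
    apply: le_trans (le_occupation alpha3 _ _ (fun y => le_step alpha3 y hb)) _.
    have -> : P (fun y => D * g y + 8 / r * sqnorm y) =
        (fun y => D * P g y + 8 / r * P sqnorm y).
      by apply/funext => y; rewrite stepD !stepZ.
    rewrite occupationD !occupationZ.
    apply: lerD.
      rewrite ler_wpM2l //; have := mean_le n (1, 1); rewrite path_sum_mean.
      rewrite occupationS addrAC subrr add0r; apply: le_trans.
      rewrite /occupation (step_sum alpha n (fun k => expect k g)) le_eqVlt; apply/orP; left; apply/eqP.
      by apply: eq_bigr => k _; rewrite expect_step.
    rewrite ler_wpM2l ?divr_ge0 ?(ltW r0) //.
    have : occupation n (P sqnorm) (1, 1) <= \sum_(k < n) (2 * r ^+ 2).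
      apply: ler_sum => k _; rewrite expect_step -expectS.
      apply: le_trans (expect_sqnorm alpha3 _ _) _; rewrite rr.
      have : k.+1%:R <= n%:R :> R by rewrite ler_nat ltn_ord.
      by rewrite -[n.+1]addn1 natrD; lra.
    by rewrite sumr_const card_ord -mulr_natr => /le_trans; apply; lra.
  have e8 : 8 / r * (2 * n%:R * r ^+ 2) = 16 * (n%:R * r).
    by field; rewrite gt_eqF.
  rewrite e8 in t1.
  have o1 : occupation n g (1, 1) + 1 <= (kappa + 2) * u.
    have := occ_le n _ (leqnn n) x02.
    rewrite (_ : kappa / L * n%:R = kappa * u); last by rewrite Lu mulrA divfK ?gt_eqF.
    have : eta * u <= u by rewrite ler_piMl // ltW.
    by lra.
  have o2 : occupation n g (1, 1) + 1 <= 2 * n%:R.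
    have : occupation n g (1, 1) <= \sum_(k < n) 1.
      by apply: ler_sum => k _; have /andP[] := eg k (1, 1).
    by rewrite sumr_const card_ord; lra.
  have o0 : 0 <= occupation n g (1, 1) by exact: occupation_ge0.
  move: (occupation n g (1, 1)) o0 o1 o2 t1 => o o0 o1 o2 t1.
  have d1 : (2 * (eta * u + 1)) * (o + 1) <= 4 * eta * u * ((kappa + 2) * u).
    by apply: ler_pM => //; lra.
  have d2 : (19 + 4 * r) * (o + 1) <= 23 * r * (2 * n%:R).
    by apply: ler_pM => //; lra.
  have e9 : D * (o + 1) = (2 * (eta * u + 1)) * (o + 1) + (19 + 4 * r) * (o + 1).
    by rewrite /D; ring.
  rewrite e9 in t1.
  have u2 : 0 <= n%:R * r by rewrite mulr_ge0 // ltW.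
  by lra.
rewrite (eq_path_expect _ _ (G := fun l => path_sum g l ^+ 2 +
   (- 2 * kappa * u * path_sum g l + kappa ^+ 2 * u ^+ 2))) => [|l]; last by ring.
rewrite !path_expectD (path_expectZ n (- 2 * kappa * u)) path_expect_cst.
have ku : 2 * kappa * u * ((kappa - 2 * eta) * u) <=
    2 * kappa * u * path_expect n (path_sum g) (1, 1).
  by rewrite ler_wpM2l // !mulr_ge0 // ltW.
by lra.
Qed.

Lemma path_sum_concentration g : (forall y, 0 <= g y <= axis y) ->
  0 < g (0, 0) ->
  exists2 kappa : R, 0 < kappa & forall eta : R, 0 < eta ->
  \forall n \near \oo,
    path_expect n (fun l => (path_sum g l - kappa * (n%:R / ln n%:R)) ^+ 2) (1, 1)
      <= eta * (n%:R / ln n%:R) ^+ 2.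
Proof.
move=> gb gO; have [kappa k0 Hk] := occupation_growth alpha3 gb gO.
exists kappa => // eta' e0'.
(* [12 * kappa + 9] is the loss in [path_sum_variance] *)
pose eta := Num.min 1 (eta' / (12 * kappa + 9)).
have k9 : 0 < 12 * kappa + 9 by lra.
have e0 : 0 < eta by rewrite lt_min ltr01 divr_gt0.
have e1 : eta <= 1 by rewrite ge_min lexx.
have ee : eta * (12 * kappa + 9) <= eta'.
  by rewrite -ler_pdivlMr // ge_min lexx orbT.
have e78 : 0 < eta / 78 by rewrite divr_gt0 // (ltr0n R 78).
near=> n.
have n0 : (0 < n)%N by near: n; exists 1%N.
apply: le_trans (path_sum_variance (eta := eta) gb k0 _ n0 _ _ _) _.
- by rewrite e0.
- by near: n; exact: near_le_ln.
- by rewrite -[leLHS]mul1r; near: n; exact: near_sqrt_ln.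
- by near: n; exact: Hk.
by rewrite ler_wpM2r // sqr_ge0.
Unshelve. all: by end_near. Qed.

End Paths.

(** * The law of the trajectory *)

Section Law.
Variables (R : realType) (alpha : R).
Hypothesis alpha3 : 3 < alpha.
Variables (d : measure_display) (T : measurableType d) (P : probability T R).
Variable X : nat -> T -> int * int.
Hypothesis chainX : is_chain alpha P X.
Implicit Types (x : nat -> int * int) (y : int * int) (n m : nat).
Implicit Types (Q : set (seq (int * int))).

Definition trajectory m n (t : T) : seq (int * int) :=
  [seq X i t | i <- iota m n].

Definition prefix_event x n : set T :=
  [set t | forall i, (i <= n)%N -> X i t = x i].

Lemma measurable_at n (A : set (int * int)) : measurable [set t | A (X n t)].
Proof. by have [mX _ _] := chainX; exact: mX. Qed.

Lemma measurable_trajectory m n Q : measurable [set t | Q (trajectory m n t)].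
Proof.
elim: n m Q => [|n IH] m Q.
  have [q|q] := pselect (Q [::]).
    by rewrite (_ : [set _ | _] = setT) //; apply/seteqP; split.
  by rewrite (_ : [set _ | _] = set0) //; apply/seteqP; split.
pose F k : set T := if unpickle k is Some y
  then [set t | X m t = y] `&` [set t | Q (y :: trajectory m.+1 n t)] else set0.
rewrite (_ : [set _ | _] = \bigcup_k F k).
  apply: bigcup_measurable => k _; rewrite /F; case: unpickle => // y.
  apply: measurableI; first exact: (measurable_at m [set y]).
  exact: (IH m.+1 [set l | Q (y :: l)]).
apply/seteqP; split=> t /=.
  by move=> Qt; exists (pickle (X m t)); [exact: I | rewrite /F pickleK].
move=> [k _]; rewrite /F; case: unpickle => // y [/= <-]; exact.
Qed.

Lemma prefix_eventS x n :
  prefix_event x n.+1 = prefix_event x n `&` [set t | X n.+1 t = x n.+1].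
Proof.
apply/seteqP; split=> t.
  by move=> h; split=> [i ni|]; apply: h => //; exact: leqW.
by move=> [h e] i; rewrite leq_eqVlt ltnS => /orP[/eqP ->|/h].
Qed.

Lemma measurable_prefix x n : measurable (prefix_event x n).
Proof.
elim: n => [|n IH].
  rewrite (_ : prefix_event _ _ = [set t | [set x 0%N] (X 0%N t)]).
    exact: measurable_at.
  apply/seteqP; split=> t /= h; first exact: h.
  by move=> i; rewrite leqn0 => /eqP ->.
by rewrite prefix_eventS; apply: measurableI => //;
  exact: (measurable_at n.+1 [set x n.+1]).
Qed.

(** Only the values up to [n.+1] matter in [prefix_event], so the value [y] at
    [n.+1] is repeated afterwards. *)
Definition extend x n y : nat -> int * int :=
  fun i => if (i <= n)%N then x i else y.

Lemma prefix_extend x n y :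
  prefix_event (extend x n y) n.+1 = prefix_event x n `&` [set t | X n.+1 t = y].
Proof.
rewrite prefix_eventS {2}/extend ltnn; congr (_ `&` _).
by apply/seteqP; split=> t h i ni; have := h i ni; rewrite /extend ni.
Qed.

Lemma prefix_extend_prob x n y : P (prefix_event x n `&` [set t | X n.+1 t = y]) =
  (P (prefix_event x n) * (trans alpha (x n) y)%:E)%E.
Proof.
have [_ _ step] := chainX; rewrite -prefix_extend.
have := step n (extend x n y); rewrite /extend leqnn ltnn => ->.
congr (P _ * _)%E; rewrite /prefix_event.
by apply/seteqP; split=> t h i ni; have := h i ni; rewrite ni.
Qed.

(** Each single jump to a non-neighbour has probability [0], and the lattice is
    countable. *)
Lemma jump_null x n :
  P (prefix_event x n `&` [set t | X n.+1 t \notin nbs (x n)]) = 0%E.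
Proof.
apply: measure_negligible.
  apply: measurableI; first exact: measurable_prefix.
  exact: (measurable_at n.+1 [set y | y \notin nbs (x n)]).
pose F k : set T := if unpickle k is Some y
  then if y \notin nbs (x n) then prefix_event x n `&` [set t | X n.+1 t = y]
       else set0 else set0.
apply: (@negligibleS _ _ _ _ (\bigcup_k F k)).
  move=> t [h hn]; exists (pickle (X n.+1 t)); first exact: I.
  by rewrite /F pickleK hn.
apply: negligible_bigcup => k; rewrite /F; case: unpickle => [y|].
  case: ifP => yn; last exact: negligible_set0.
  apply/negligibleP.
    apply: measurableI; first exact: measurable_prefix.
    exact: (measurable_at n.+1 [set y]).
  have := prefix_extend_prob x n y.
  by rewrite trans_off_nbs // mule0.
exact: negligible_set0.
Qed.

Lemma measure_bigsetU_le (I : Type) (s : seq I) (A : I -> set T) :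
  (forall i, measurable (A i)) ->
  (P (\big[setU/set0]_(i <- s) A i) <= \sum_(i <- s) P (A i))%E.
Proof.
move=> mA; elim: s => [|i s IH]; first by rewrite !big_nil measure0.
rewrite !big_cons; apply: le_trans (measureU2 _ _ _) _ => //.
  exact: bigsetU_measurable.
exact: leeD2l.
Qed.

(** The trajectory is split according to its next vertex: a neighbour, which
    contributes one term of [step], or another point, which has probability [0]
    by [jump_null]. *)
Lemma trajectory_law x m n Q :
  (P (prefix_event x m `&` [set t | Q (trajectory m.+1 n t)]) <=
   P (prefix_event x m) *
     (path_expect alpha n (fun l => (`[< Q l >])%:R) (x m))%:E)%E.
Proof.
elim: n x m Q => [|n IH] x m Q.
  rewrite /=; case: (asboolP (Q [::])) => q.
    rewrite mule1; apply: le_measure; rewrite ?inE; [|exact: measurable_prefix|].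
      apply: measurableI; first exact: measurable_prefix.
      exact: (measurable_trajectory m.+1 0 Q).
    by move=> t [].
  by rewrite mule0 (_ : _ `&` _ = set0) ?measure0 //; apply/seteqP; split=> t [].
pose A y := prefix_event (extend x m y) m.+1 `&`
  [set t | Q (y :: trajectory m.+2 n t)].
have mA y : measurable (A y).
  apply: measurableI; first exact: measurable_prefix.
  exact: (measurable_trajectory m.+2 n [set l | Q (y :: l)]).
pose B := prefix_event x m `&` [set t | X m.+1 t \notin nbs (x m)].
have mB : measurable B.
  apply: measurableI; first exact: measurable_prefix.
  exact: (measurable_at m.+1 [set y | y \notin nbs (x m)]).
have mU : measurable (\big[setU/set0]_(y <- nbs (x m)) A y).
  exact: bigsetU_measurable.
apply: (@le_trans _ _ (P (\big[setU/set0]_(y <- nbs (x m)) A y `|` B))).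
  apply: le_measure; rewrite ?inE.
  - apply: measurableI; first exact: measurable_prefix.
    exact: (measurable_trajectory m.+1 n.+1 Q).
  - exact: measurableU.
  move=> t [h q].
  have [yn|yn] := boolP (X m.+1 t \in nbs (x m)); last by right; split.
  left; rewrite -bigcup_seq; exists (X m.+1 t) => //.
  by split => //; rewrite prefix_extend; split.
apply: le_trans (measureU2 _ _ _) _ => //.
rewrite [X in (_ + X)%E]jump_null adde0.
apply: le_trans (measure_bigsetU_le _ mA) _.
rewrite path_expectS /step -sumEFin ge0_sume_distrr => [|y _]; last first.
  rewrite lee_fin mulr_ge0 ?trans_ge0 // -(path_expect_cst alpha n 0 y).
  exact: le_path_expect.
apply: lee_sum => y _; apply: le_trans (IH (extend x m y) m.+1 [set l | Q (y :: l)]) _.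
rewrite {2}/extend ltnn prefix_extend prefix_extend_prob.
by rewrite -muleA -EFinM.
Qed.

Lemma event_le n Q : (P [set t | Q (trajectory 1 n t)] <=
   (path_expect alpha n (fun l => (`[< Q l >])%:R) (1, 1))%:E)%E.
Proof.
have [_ X0 _] := chainX; have mX := @measurable_at.
pose x : nat -> int * int := fun=> (1, 1).
have start : prefix_event x 0 = [set t | X 0%N t = (1, 1)].
  apply/seteqP; split=> t h; first exact: h.
  by move=> i; rewrite leqn0 => /eqP ->.
have ms : measurable (prefix_event x 0) := measurable_prefix x 0.
have mQ := measurable_trajectory 1 n Q.
have null : P (~` prefix_event x 0) = 0%E.
  by rewrite probability_setC // start X0 subee.
have := trajectory_law x 0 n Q; rewrite {2}start X0 mul1e; apply: le_trans.
apply: (@le_trans _ _ (P ((prefix_event x 0 `&`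
    [set t | Q (trajectory 1 n t)]) `|` ~` prefix_event x 0))).
  apply: le_measure; rewrite ?inE //.
    by apply: measurableU; [exact: measurableI | exact: measurableC].
  move=> t q; have [h|h] := pselect (prefix_event x 0 t); first by left.
  by right.
apply: le_trans (measureU2 _ _ _) _.
- exact: measurableI.
- exact: measurableC.
by rewrite [X in (_ + X)%E]null adde0.
Qed.

Lemma local_timeE (A : set (int * int)) n t :
  local_time X A n t = path_sum (\1_A) (trajectory 1 n t) :> R.
Proof.
by rewrite /local_time /path_sum /trajectory big_map /index_iota subSS subn0.
Qed.

Lemma cvg_to0 (f : nat -> \bar R) : (forall n, 0 <= f n)%E ->
  (forall eta : R, 0 < eta -> \forall n \near \oo, (f n <= eta%:E)%E) ->
  f n @[n --> \oo] --> 0%E.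
Proof.
move=> f0 fe.
have fin n (eta : R) : (f n <= eta%:E)%E -> f n \is a fin_num.
  move=> h; rewrite ge0_fin_numE //; exact: le_lt_trans h (ltry _).
apply/fine_cvgP; split.
  by apply: filterS (fe 1 ltr01) => n; exact: fin.
apply/cvgr0Pnorm_le => eta e0; apply: filterS (fe eta e0) => n h /=.
by rewrite ger0_norm ?fine_ge0 // -lee_fin fineK // (fin _ _ h).
Qed.

(** Chebyshev's inequality under the law of the trajectory. *)
Lemma concentration_cvg (A : set (int * int)) (kappa : R) :
  (forall eta : R, 0 < eta -> \forall n \near \oo,
    path_expect alpha n
      (fun l => (path_sum (\1_A) l - kappa * (n%:R / ln n%:R)) ^+ 2) (1, 1)
      <= eta * (n%:R / ln n%:R) ^+ 2) ->
  cvg_in_probability P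
    (fun n t => ln n%:R / n%:R * local_time X A n t) kappa.
Proof.
move=> H eps eps0; apply: cvg_to0 => // eta eta0.
have e0 : 0 < eta * eps ^+ 2 by rewrite mulr_gt0 // exprn_gt0.
near=> n.
have L1 : 1 <= ln n%:R :> R by near: n; exact: near_le_ln.
have N1 : 1 <= n%:R :> R by near: n; exact: nbhs_infty_ger.
pose Q l := eps < `|ln n%:R / n%:R * path_sum (\1_A) l - kappa|.
rewrite (_ : [set t | _] = [set t | Q (trajectory 1 n t)]); last first.
  by apply/seteqP; split=> t /=; rewrite local_timeE.
apply: le_trans (event_le n Q) _; rewrite lee_fin.
have : path_expect alpha n
      (fun l => (path_sum (\1_A) l - kappa * (n%:R / ln n%:R)) ^+ 2) (1, 1)
      <= eta * eps ^+ 2 * (n%:R / ln n%:R) ^+ 2 by near: n; exact: H.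
set u := n%:R / ln n%:R; have u0 : 0 < u by apply: divr_gt0; lra.
have cheb l : (`[< Q l >])%:R <=
    (eps * u) ^- 2 * (path_sum (\1_A) l - kappa * u) ^+ 2 :> R.
  have p0 : 0 <= (path_sum (\1_A) l - kappa * u) ^+ 2 := sqr_ge0 _.
  case: asboolP => q /=; last first.
    by rewrite mulr_ge0 // invr_ge0 exprn_ge0 // mulr_ge0 // ltW.
  have : (eps * u) ^+ 2 <= (path_sum \1_A l - kappa * u) ^+ 2.
    rewrite -[leRHS]real_normK ?num_real // ler_pXn2r ?nnegrE //; last first.
      by rewrite mulr_ge0 // ltW.
    have -> : path_sum \1_A l - kappa * u =
        u * (ln n%:R / n%:R * path_sum \1_A l - kappa).
      by rewrite /u; field; rewrite !gt_eqF; lra.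
    by rewrite normrM (gtr0_norm u0) mulrC ler_wpM2l ?ltW.
  move=> q2; rewrite [leRHS]mulrC ler_pdivlMr; last first.
    by rewrite exprn_gt0 // mulr_gt0.
  by lra.
move=> HE; apply: le_trans (le_path_expect alpha3 n (1, 1) cheb) _.
rewrite path_expectZ [leLHS]mulrC ler_pdivrMr; last first.
  by rewrite exprn_gt0 // mulr_gt0.
apply: le_trans HE _; rewrite le_eqVlt; apply/orP; left; apply/eqP; ring.
Unshelve. all: by end_near. Qed.

End Law.

Lemma indic_axis (R : realType) : \1_Kc = @axis R.
Proof.
apply/funext => y; rewrite indicE /axis; congr (_ %:R); congr nat_of_bool.
by apply/idP/eqP; rewrite inE.
Qed.

Lemma indic_origin (R : realType) : \1_[set (0, 0)] = @origin R.
Proof.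
apply/funext => y; rewrite indicE /origin; congr (_ %:R); congr nat_of_bool.
by apply/idP/eqP; rewrite inE.
Qed.

Theorem theorem1p1 (R : realType) (alpha : R) (halpha : 3 < alpha) :
  exists c c' : R,
    [/\ 0 < c, 0 < c' &
      forall (d : measure_display) (T : measurableType d)
        (P : probability T R) (X : nat -> T -> int * int),
        is_chain alpha P X ->
        cvg_in_probability P
          (fun n t => ln n%:R / n%:R * local_time X [set (0, 0)] n t) c' /\
        cvg_in_probability P
          (fun n t => ln n%:R / n%:R * local_time X Kc n t) c].
Proof.
have axisb y : 0 <= axis R y <= axis R y by rewrite lexx ler0n.
have originb y : 0 <= origin R y <= axis R y.
  by rewrite origin_le_axis ler0n.
have [c c0 Hc] := path_sum_concentration halpha axisb ltr01.
have [c' c'0 Hc'] := path_sum_concentration halpha originb ltr01.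
exists c, c'; split=> // d T P X chainX; split.
  by apply: (concentration_cvg halpha chainX); rewrite indic_origin.
by apply: (concentration_cvg halpha chainX); rewrite indic_axis.
Qed.
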